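(* Let $\nu>0$, $0<T<\infty$, and let $u$ be a Leray-Hopf solution on $[0,T]$ of the 3D Navier-Stokes equations $\partial_t u-\nu\Delta u+(u\cdot\nabla)u+\nabla p=0$, $\nabla\cdot u=0$ on $\mathbb{R}^3$. Let $\Lambda(t)=2^{Q(t)}$ be its dissipation wavenumber defined in the context, write $\langle g\rangle=\frac1T\int_0^T g(t)\,dt$, and let $\epsilon=\nu\langle\|\nabla u\|_2^2\rangle$ be the energy dissipation rate. Let $s\in[0,3]$ be any parameter for which $$\langle\Lambda^{2-s}\|u_Q\|_\infty^2\rangle\lesssim\langle\Lambda^2\|u_Q\|_2^2\rangle,$$ let $d=3-s$ be the corresponding intermittency dimension, and let $\kappa_{\mathrm d}=\left(\epsilon/\nu^3\right)^{1/(d+1)}$. Then $$\langle\Lambda\rangle\lesssim\kappa_{\mathrm d}.$$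
   Context: Notation: $A\lesssim B$ means $A\le CB$ with an absolute constant $C$ (inequality up to an absolute multiple). Weak solution: for divergence-free $u_0\in L^2(\mathbb{R}^3)$, a weak solution on $[0,T]$ with initial data $u_0$ is a vector field $u\in C_{\mathrm w}([0,T];L^2(\mathbb{R}^3))$ (weakly continuous in time) with $u(0)=u_0$, $\nabla_x\cdot u(t)=0$ in the sense of distributions for all $t\in[0,T]$, and $$(u(t),\varphi(t))-(u_0,\varphi(0))=\int_0^t\{(u(s),\partial_s\varphi(s))+\nu(u(s),\Delta\varphi(s))+(u(s)\cdot\nabla\varphi(s),u(s))\}\,ds$$ for all $t\in[0,T]$ and all vector-valued test functions $\varphi\in C_0^\infty([0,T]\times\mathbb{R}^3)$ with $\nabla_x\cdot\varphi=0$, where $(\cdot,\cdot)$ is the $L^2$ inner product. Leray-Hopf solution ($\nu>0$): a weak solution with $u\in L^2([0,T];H^1(\mathbb{R}^3))$ satisfying $\|u(t)\|_2^2+2\nu\int_{t_0}^t\|\nabla u(s)\|_2^2\,ds\le\|u(t_0)\|_2^2$ for almost all $t_0\in(0,T)$ and all $t\in(t_0,T]$. Littlewood-Paley notation: $\lambda_q=2^q$. Fix a nonnegative radial $\chi\in C_0^\infty(B_1)$, $B_1\subset\mathbb{R}^3$ the unit ball centered at $0$, with $\chi(\xi)=1$ for $|\xi|\le 1/2$; $\varphi(\xi)=\chi(\xi/2)-\chi(\xi)$, $\varphi_q(\xi)=\varphi(2^{-q}\xi)$. With $\mathcal F$ the Fourier transform, for a tempered distribution $u$: $u_q=\mathcal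 F^{-1}(\varphi_q)*u$ for $q\ge0$, $u_{-1}=\mathcal F^{-1}(\chi)*u$. Dissipation wavenumber: with $c_0>0$ a fixed absolute constant, $\Lambda(t)=\min\{\lambda_q:\ q\ge0,\ \lambda_p^{-1}\|u_p(t)\|_\infty<c_0\nu\ \text{ for all } p>q\}$, with $\Lambda(t)=\infty$ if no such $q$ exists (for a Leray-Hopf solution $\Lambda(t)<\infty$ for a.e. $t$), and $Q(t)$ is defined by $\lambda_{Q(t)}=\Lambda(t)$. In the averages, $u_Q$ denotes $u_{Q(t)}(t)$, the $Q(t)$-th Littlewood-Paley piece of $u(t)$.
   Formalization: The conclusion is proved as ⟨Λ⟩ − λ_0 ≲ κ_d with λ_0 = 1 instead of ⟨Λ⟩ ≲ κ_d, because Λ ≥ 1 always and the literal claim fails for u = 0, where κ_d = 0; whenever κ_d is bounded below the literal claim follows. *)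

(* Defs.v *)
From HB Require Import structures.
From mathcomp Require Import all_boot all_order all_algebra.
From mathcomp Require Import all_classical all_reals all_analysis.
From mathcomp Require Import complex.

Set Implicit Arguments.
Unset Strict Implicit.
Unset Printing Implicit Defensive.
Import Order.TTheory GRing.Theory Num.Theory.
Import numFieldNormedType.Exports.

Local Open Scope classical_set_scope.
Local Open Scope ring_scope.

(* Points of space are triples ((x_0, x_1), x_2). The norm that MathComp puts
   on a product is the max norm; it is used for the topology only, Euclidean
   lengths being given by [euclid]. *)
Notation R3 R := (R * R * R)%type (only parsing).

(* A field with components indexed by I: I = 'I_3 for a vector field, and
   I = 'I_3 * 'I_3 for its gradient. Elements of L^2 are represented by
   functions, and no condition below depends on the representative. *)
Notation tfield R I := (I -> R3 R -> R) (only parsing).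
Notation vfield R := (tfield R 'I_3) (only parsing).

Section Euclidean.
Context {R : realType}.
Implicit Types x y : R3 R.

Definition dot x y : R := x.1.1 * y.1.1 + x.1.2 * y.1.2 + x.2 * y.2.

Definition euclid x : R := Num.sqrt (dot x x).

Definition basis (i : 'I_3) : R3 R :=
  ((i == 0 :> nat)%:R, (i == 1 :> nat)%:R, (i == 2 :> nat)%:R).

Definition leb3 :=
  [the {measure set (measurableTypeR R * measurableTypeR R *
                     measurableTypeR R)%type -> \bar R}
   of ((@lebesgue_measure R \x @lebesgue_measure R) \x @lebesgue_measure R)%E].

End Euclidean.

Section TestFunctions.
Context {R : realType} {V : normedModType R}.
Implicit Types f : V -> R.

(* C^oo on a finite-dimensional V: directional derivatives of all orders
   exist everywhere and are continuous. *)
Definition iter_derive f (vs : seq V) : V -> R :=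
  foldr (fun v g => 'D_v g) f vs.

Definition smooth f : Prop :=
  forall vs : seq V, continuous (iter_derive f vs) /\
    forall v x, derivable (iter_derive f vs) x v.

Definition supp f : set V := closure [set x | f x != 0].

Definition test_function f : Prop := smooth f /\ compact (supp f).

End TestFunctions.

Section Lebesgue.
Context {R : realType}.

Definition magnitude (I : finType) (f : tfield R I) (x : R3 R) : R :=
  Num.sqrt (\sum_i f i x ^+ 2).

Definition Lp_norm (I : finType) (p : \bar R) (f : tfield R I) : \bar R :=
  'N[leb3]_p[EFin \o magnitude f]%E.

Definition inL2 (I : finType) (f : tfield R I) : Prop :=
  forall i, f i \in Lfun leb3 2%:E.

Definition inner (f g : vfield R) : R :=
  \int[leb3]_x \sum_i f i x * g i x.

Definition div_free (f : vfield R) : Prop :=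
  forall psi : R3 R -> R, test_function psi ->
    \int[leb3]_x (\sum_i f i x * 'D_(basis i) psi x) = 0.

Definition is_weak_derivative (f : R3 R -> R) (j : 'I_3) (g : R3 R -> R) :=
  g \in Lfun leb3 2%:E /\
  forall psi : R3 R -> R, test_function psi ->
    \int[leb3]_x (f x * 'D_(basis j) psi x) = - \int[leb3]_x (g x * psi x).

Definition inH1 (f : vfield R) : Prop :=
  inL2 f /\ forall i j, exists g, is_weak_derivative (f i) j g.

(* The weak gradient of f; each component is determined a.e. when f is in H^1,
   and is a junk value otherwise. *)
Definition gradient (f : vfield R) : tfield R ('I_3 * 'I_3)%type :=
  fun ij => xget (fun=> 0) [set g | is_weak_derivative (f ij.1) ij.2 g].

End Lebesgue.

Section NavierStokes.
Context {R : realType}.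
Implicit Types (nu T : R) (u : R -> vfield R).

(* Vector-valued test functions on [0, T] x R^3 do not have to vanish at times
   0 and T: they are the restrictions of compactly supported smooth functions
   on R x R^3, and the divergence is only required to vanish for t in [0, T]. *)
Definition dt (f : R * R3 R -> R) (t : R) (x : R3 R) : R := 'D_(1, 0) f (t, x).

Definition dx (i : 'I_3) (f : R * R3 R -> R) (t : R) (x : R3 R) : R :=
  'D_(0, basis i) f (t, x).

Definition laplacian (f : R * R3 R -> R) (t : R) (x : R3 R) : R :=
  \sum_i dx i (fun z => dx i f z.1 z.2) t x.

Definition solenoidal_test T (phi : 'I_3 -> R * R3 R -> R) : Prop :=
  (forall i, test_function (phi i)) /\
  forall (t : R) (x : R3 R), 0 <= t <= T -> \sum_i dx i (phi i) t x = 0.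

Definition weak_solution nu T (u0 : vfield R) u : Prop :=
  [/\ forall t : R, 0 <= t <= T -> inL2 (u t),
      forall w : vfield R, inL2 w ->
        {within `[0, T], continuous (fun t : R => inner (u t) w)},
      forall i, {ae leb3, forall x, u 0 i x = u0 i x},
      forall t : R, 0 <= t <= T -> div_free (u t) &
      forall phi, solenoidal_test T phi -> forall t : R, 0 <= t <= T ->
        inner (u t) (fun i x => phi i (t, x)) -
        inner u0 (fun i x => phi i (0, x)) =
        \int[lebesgue_measure]_(r in `[0, t])
          (inner (u r) (fun i => dt (phi i) r) +
           nu * inner (u r) (fun i => laplacian (phi i) r) +
           inner (fun i x => \sum_j u r j x * dx j (phi i) r x) (u r))].

Definition in_L2H1 T u : Prop :=
  {ae lebesgue_measure, forall t : R, 0 <= t <= T -> inH1 (u t)} /\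
  (\int[lebesgue_measure]_(t in `[0%R, T])
     (Lp_norm 2%:E (u t) ^+ 2 + Lp_norm 2%:E (gradient (u t)) ^+ 2) < +oo)%E.

Definition leray_hopf nu T (u0 : vfield R) u : Prop :=
  [/\ inL2 u0, div_free u0, weak_solution nu T u0 u, in_L2H1 T u &
      {ae lebesgue_measure, forall t0 : R, 0 < t0 < T ->
        forall t : R, t0 < t <= T ->
        (Lp_norm 2%:E (u t) ^+ 2 +
         (2 * nu)%:E * \int[lebesgue_measure]_(r in `[t0, t])
                          Lp_norm 2%:E (gradient (u r)) ^+ 2 <=
         Lp_norm 2%:E (u t0) ^+ 2)%E}].

End NavierStokes.

Section LittlewoodPaley.
Context {R : realType}.
Implicit Types (chi g : R3 R -> R) (f : vfield R) (q : nat).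

Definition lp_cutoff chi : Prop :=
  [/\ test_function chi,
      supp chi `<=` [set xi | euclid xi < 1],
      forall xi, 0 <= chi xi,
      forall xi eta, euclid xi = euclid eta -> chi xi = chi eta &
      forall xi, euclid xi <= 2^-1 -> chi xi = 1].

Definition lambda q : R := 2 ^+ q.

Definition lp_multiplier chi q (xi : R3 R) : R :=
  let phi (xi : R3 R) := chi (2^-1 *: xi) - chi xi in phi (2 ^- q *: xi).

(* (2 pi)^-3 \int g(xi) e^(i x.xi) dxi *)
Definition inverse_fourier g (x : R3 R) : R[i] :=
  let c := (2 * pi) ^- 3 in
  Complex (c * \int[leb3]_xi (g xi * cos (dot x xi)))
          (c * \int[leb3]_xi (g xi * sin (dot x xi))).

(* The multipliers are radial, so that their inverse Fourier transforms are
   real-valued. *)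
Definition lp_kernel chi q (x : R3 R) : R :=
  complex.Re (inverse_fourier (lp_multiplier chi q) x).

Definition lp_piece chi q f : vfield R :=
  fun i x => \int[leb3]_y (lp_kernel chi q (x - y) * f i y).

(* The infimum of a set of powers 2^q is attained, unless the set is empty,
   in which case it is +oo. As q ranges over naturals, the wavenumber is at
   least lambda 0 = 1 for every f, including f = 0. *)
Definition wavenumber chi (c0 nu : R) f : \bar R :=
  ereal_inf [set (lambda q)%:E | q in
    [set q | forall p, (q < p)%N ->
       ((lambda p)^-1%:E * Lp_norm +oo (lp_piece chi p f) < (c0 * nu)%:E)%E]].

(* Junk value 0 if the wavenumber is infinite. *)
Definition wave_index chi (c0 nu : R) f : nat :=
  xget 0%N [set q | (lambda q)%:E = wavenumber chi c0 nu f].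

Definition critical_piece chi (c0 nu : R) f : vfield R :=
  lp_piece chi (wave_index chi c0 nu f) f.

End LittlewoodPaley.

Section Averages.
Context {R : realType}.
Implicit Types (nu T : R) (u : R -> vfield R).

Definition mean T (g : R -> \bar R) : \bar R :=
  (T^-1%:E * \int[lebesgue_measure]_(t in `[0%R, T]) g t)%E.

Definition dissipation nu T u : \bar R :=
  (nu%:E * mean T (fun t => Lp_norm 2%:E (gradient (u t)) ^+ 2))%E.

Definition kolmogorov nu T u (d : R) : \bar R :=
  ((dissipation nu T u * (nu ^- 3)%:E) `^ (d + 1)^-1)%E.

End Averages.

(* Main.v *)
Require Import Defs.
From HB Require Import structures.
From mathcomp Require Import all_boot all_order all_algebra.
From mathcomp Require Import all_classical all_reals all_analysis.
From mathcomp Require Import measurable_realfun ess_sup_inf hoelder.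
From mathcomp Require Import ring lra.
Import Order.TTheory GRing.Theory Num.Theory.
Import numFieldNormedType.Exports.
Set Implicit Arguments.
Unset Strict Implicit.
Unset Printing Implicit Defensive.
Local Open Scope classical_set_scope.
Local Open Scope ring_scope.

(* Let A > 0 and p = 4 - s. At a time where Lambda > 1, minimality of Lambda
   gives ||u_Q||_oo >= c0 nu Lambda, hence
     Lambda <= 1 + A + A^(1 - p) (c0 nu)^-2 Lambda^(2 - s) ||u_Q||_oo^2.
   Averaging in time, the hypothesis on s and Bernstein's inequality
   Lambda ||u_Q||_2 <= C ||grad u||_2 bound <Lambda> - 1 by
   A + C A^(1 - p) nu^-2 <||grad u||_2^2>, and A = kappa_d is the optimal
   choice of A up to a constant.

   For the Littlewood-Paley estimates, the kernel of the q-th piece is written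
   as a divergence sum_j D_j M_j, the M_j being Fourier integrals of test
   functions, so that the piece of f is sum_j M_j * D_j f; integrating by parts
   in frequency, M_j is dominated by 4^q k(2^q x), where k is the product of
   three Cauchy densities. *)

(** * Smooth functions *)

Section SmoothCalculus.
Context {R : realType} {V : normedModType R}.
Implicit Types f g : V -> R.

(** The averages in time involve an infimum of wavenumbers and norms of pieces of a chosen
    representative, with no measurability in t at hand. Their integrals are therefore treated as
    suprema over simple functions: such integrals are monotone, and they obey an upper bound when a
    positive multiple is taken and a constant added. The inequality for Lambda is affine in
    Lambda^(2 - s) ||u_Q||_oo^2 so that this is enough. In space, the annulus multiplier vanishes
    near the origin, so dividing it by |xi|^2 is harmless; this trades f for its weak gradient and
    gains 2^-q. Cauchy-Schwarz with weight k then gives the pointwise majorant k * |grad f|^2 for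
    the square of a piece, up to constants. The supremum of k turns it into the L^oo bound that
    makes Lambda finite at almost every time, and the integral of k turns it into Bernstein's
    inequality. The weight is a product because decay is produced one coordinate at a time by the
    operators 1 - D_j^2, which also makes its integral explicit. *)

Fixpoint Ck n f : Prop := continuous f /\
  if n is m.+1 then forall v, (forall x, derivable f x v) /\ Ck m ('D_v f)
  else True.

Lemma smooth_derive f v : smooth f -> smooth ('D_v f).
Proof. by move=> sf vs; have := sf (rcons vs v); rewrite /iter_derive foldr_rcons. Qed.

Lemma smooth_continuous f : smooth f -> continuous f.
Proof. by move=> /(_ [::])[]. Qed.

Lemma smooth_derivable f x v : smooth f -> derivable f x v.
Proof. by move=> /(_ [::])[_]; exact. Qed.

(** [iter_derive] takes the last direction of the list first. [Ck] peels off exactly this innermost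
    derivative, so that closure properties follow by induction on the order, uniformly in the
    functions. *)
Lemma smoothP f : smooth f <-> forall n, Ck n f.
Proof.
split=> [sf n|].
  elim: n f sf => [|n IH] f sf; first by split => //; exact: smooth_continuous.
  split; first exact: smooth_continuous.
  move=> v; split; first by move=> x; exact: smooth_derivable.
  exact/IH/smooth_derive.
move=> Cf vs; elim/last_ind: vs f Cf => [|vs v IH] f Cf.
  split; first by case: (Cf 0%N).
  by move=> v; case: (Cf 1%N) => _ /(_ v)[].
rewrite /iter_derive foldr_rcons; apply: IH => n.
by case: (Cf n.+1) => _ /(_ v)[].
Qed.

Lemma CkW n f : Ck n.+1 f -> Ck n f.
Proof.
elim: n f => [|n IH] f [cf df]; first by split.
split => // v; split; first by case: (df v).
by apply: IH; case: (df v).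
Qed.

Lemma Ck_cst n (c : R) : Ck n (fun=> c).
Proof.
elim: n c => [|n IH] c; first by split=> // x; exact: cvg_cst.
split; first by move=> x; exact: cvg_cst.
move=> v; split=> [x|]; first exact: derivable_cst.
suff -> : 'D_v (fun=> c) = fun=> 0 by exact: IH.
by apply/funext => x; rewrite derive_cst.
Qed.

Lemma CkD n f g : Ck n f -> Ck n g -> Ck n (fun x => f x + g x).
Proof.
elim: n f g => [|n IH] f g [cf df] [cg dg].
  by split=> // x; apply: cvgD; [exact: cf|exact: cg].
split; first by move=> x; apply: cvgD; [exact: cf|exact: cg].
move=> v; have [dfv Cf] := df v; have [dgv Cg] := dg v.
split=> [x|]; first exact: derivableD.
suff -> : 'D_v (fun x => f x + g x) = fun x => 'D_v f x + 'D_v g x by exact: IH.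
by apply/funext => x; rewrite -deriveD.
Qed.

Lemma CkM n f g : Ck n f -> Ck n g -> Ck n (fun x => f x * g x).
Proof.
elim: n f g => [|n IH] f g Hf Hg.
  case: Hf => cf _; case: Hg => cg _; split=> // x.
  by apply: cvgM; [exact: cf|exact: cg].
have [cf df] := Hf; have [cg dg] := Hg.
split; first by move=> x; apply: cvgM; [exact: cf|exact: cg].
move=> v; have [dfv Cf] := df v; have [dgv Cg] := dg v.
split=> [x|]; first exact: derivableM.
suff -> : 'D_v (fun x => f x * g x) =
    fun x => f x * 'D_v g x + g x * 'D_v f x.
  by apply: CkD; apply: IH => //; exact: CkW.
by apply/funext => x; rewrite deriveM.
Qed.

(** The derivative - f^-2 D f involves only D f and 1/f at lower order, so the induction runs on n
    with f fixed. *)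
Lemma CkV n f : (forall x, f x != 0) -> Ck n f -> Ck n (fun x => (f x)^-1).
Proof.
move=> f0; elim: n => [|n IH] Hf.
  case: Hf => cf _; split=> // x.
  by apply: cvgV => //; exact: cf.
have [cf df] := Hf.
split; first by move=> x; apply: cvgV => //; exact: cf.
move=> v; have [dfv Cf] := df v.
split=> [x|]; first exact: derivableV.
suff -> : 'D_v (fun x => (f x)^-1) =
    fun x => (-1 * ((f x)^-1 * (f x)^-1)) * 'D_v f x.
  apply: CkM => //; apply: CkM; first exact: Ck_cst.
  by apply: CkM; apply: IH; exact: CkW.
by apply/funext => x; rewrite deriveV // scaleNr mulN1r mulNr -invfM -expr2.
Qed.

Lemma smooth_cst (c : R) : smooth ((fun=> c) : V -> R).
Proof. by apply/smoothP => n; exact: Ck_cst. Qed.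

Lemma smoothD f g : smooth f -> smooth g -> smooth (fun x => f x + g x).
Proof. by move=> /smoothP Cf /smoothP Cg; apply/smoothP => n; exact: CkD. Qed.

Lemma smoothM f g : smooth f -> smooth g -> smooth (fun x => f x * g x).
Proof. by move=> /smoothP Cf /smoothP Cg; apply/smoothP => n; exact: CkM. Qed.

Lemma smoothV f : (forall x, f x != 0) -> smooth f ->
  smooth (fun x => (f x)^-1).
Proof. by move=> f0 /smoothP Cf; apply/smoothP => n; exact: CkV. Qed.

Lemma smoothN f : smooth f -> smooth (fun x => - f x).
Proof.
move=> sf; have := smoothM (smooth_cst (-1)) sf.
by congr smooth; apply/funext => x; rewrite mulN1r.
Qed.

Lemma smoothB f g : smooth f -> smooth g -> smooth (fun x => f x - g x).
Proof. by move=> sf sg; exact: (smoothD sf (smoothN sg)). Qed.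

Lemma derive_affine f (x0 : V) (a : R) (v x : V) :
  'D_v (fun y => f (x0 + a *: y)) x = 'D_(a *: v) f (x0 + a *: x).
Proof.
rewrite /derive; set g1 := fun h => _; set g2 := fun h => _.
suff -> : g1 = g2 by [].
apply/funext => h; rewrite /g1 /g2/=; congr (_ *: (f _ - _)).
by rewrite scalerDr addrCA !scalerA mulrC.
Qed.

Lemma derivable_affine f (x0 : V) (a : R) (v x : V) :
  derivable f (x0 + a *: x) (a *: v) ->
  derivable (fun y => f (x0 + a *: y)) x v.
Proof.
rewrite /derivable; set g1 := fun h => _; set g2 := fun h => _.
suff -> : g1 = g2 by [].
apply/funext => h; rewrite /g1 /g2/=; congr (_ *: (f _ - _)).
by rewrite scalerDr addrCA !scalerA mulrC.
Qed.

Lemma smooth_affine f (x0 : V) (a : R) : smooth f ->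
  smooth (fun y => f (x0 + a *: y)).
Proof.
move=> /smoothP Cf; apply/smoothP => n; move/(_ n) : Cf.
have ca (g : V -> R) : continuous g -> continuous (fun y => g (x0 + a *: y)).
  move=> cg x; apply: (@continuous_comp _ _ _ (fun y => x0 + a *: y) g).
    by apply: cvgD; [exact: cvg_cst|apply: cvgZ; [exact: cvg_cst|exact: cvg_id]].
  exact: cg.
elim: n f => [|n IH] f [cf df]; first by split=> //; exact: ca.
split; first exact: ca.
move=> v; have [dfv Cf] := df (a *: v).
split=> [x|]; first exact: derivable_affine.
suff -> : 'D_v (fun y => f (x0 + a *: y)) =
    fun y => 'D_(a *: v) f (x0 + a *: y) by exact: (IH ('D_(a *: v) f)).
by apply/funext => x; rewrite derive_affine.
Qed.

(** Only derivability in the direction v is assumed, so no linear differential is available. The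
    increment h is rescaled to [h * a], which for nonzero a tends to 0 without meeting it. *)
Lemma derive_scale f (a : R) (v x : V) : derivable f x v ->
  is_derive x (a *: v) f (a * 'D_v f x).
Proof.
move=> df.
have [->|a0] := eqVneq a 0.
  by rewrite scale0r mul0r; exact: is_derive0.
suff H : h^-1 *: ((f \o shift x) (h *: (a *: v)) - f x) @[h --> 0^']
    --> a * 'D_v f x.
  by split; [apply/cvg_ex; eexists; exact: H|exact: cvg_lim H].
pose F (k : R) : R := k^-1 *: ((f \o shift x) (k *: v) - f x).
have -> : (fun h : R => h^-1 *: ((f \o shift x) (h *: (a *: v)) - f x)) =
   (fun h : R => a * F (h * a)).
  apply/funext => h; rewrite /F/= scalerA.
  have [->|h0] := eqVneq h 0; first by rewrite !mul0r invr0 !scale0r mulr0.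
  rewrite /GRing.scale/= mulrA; congr (_ * _).
  by rewrite invfM mulrCA mulfV// mulr1.
suff Fc : F (h * a) @[h --> 0^'] --> 'D_v f x by exact: (cvgM (cvg_cst a) Fc).
apply: (@cvg_comp _ _ _ (fun h : R => h * a) F); last exact: df.
move=> P; rewrite /nbhs/= /dnbhs/= => -[e /= e0 eP].
exists (e / `|a|); first by rewrite /= divr_gt0// normr_gt0.
move=> h /=; rewrite sub0r normrN => he h0; apply: eP => /=.
  by rewrite sub0r normrN normrM -ltr_pdivlMr// normr_gt0.
by rewrite mulf_neq0.
Qed.

End SmoothCalculus.

(** * The Lebesgue measure on R^3 *)

Section ProductMeasure.
Context {R : realType}.

(** Both exhaustions are increasing, so a point whose coordinates enter at stages n and m lies in
    the rectangle of index [maxn n m]. This is what makes Fubini's theorem applicable to [leb2] and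
    [leb3s]. *)
Lemma product_sigma_finite d1 d2 (T1 : measurableType d1)
    (T2 : measurableType d2) (m1 : {sigma_finite_measure set T1 -> \bar R})
    (m2 : {sigma_finite_measure set T2 -> \bar R}) :
  sigma_finite setT (m1 \x m2)%E.
Proof.
have /sigma_finiteP[F [FT ndF mF]] := sigma_finiteT m1.
have /sigma_finiteP[G [GT ndG mG]] := sigma_finiteT m2.
exists (fun n => F n `*` G n).
  rewrite -setXTT FT GT; apply/seteqP; split => [[x y]/= [[n _ Fx] [m _ Gy]]|].
    exists (maxn n m) => //=; split.
      by move: Fx; apply/subsetPset/ndF; rewrite leq_maxl.
    by move: Gy; apply/subsetPset/ndG; rewrite leq_maxr.
  by move=> [x y]/= [n _ [/= Fx Gy]]; split; exists n.
move=> n; have [mFn Fn] := mF n; have [mGn Gn] := mG n.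
split; first exact: measurableX.
by rewrite product_measure1E// lte_mul_pinfty// ge0_fin_numE.
Qed.

End ProductMeasure.

Section Space.
Context {R : realType}.
Notation leb := (@lebesgue_measure R).
Notation lebR3 := ((leb \x leb) \x leb)%E.
Notation mR := (measurableTypeR R).
Notation mR3 := (mR * mR * mR)%type.

Lemma normR3 (x : R3 R) :
  `|x| = Num.max (Num.max `|x.1.1| `|x.1.2|) `|x.2|.
Proof. by rewrite !prod_normE. Qed.

Lemma normR3_le (x : R3 R) r :
  (`|x| <= r) = [&& `|x.1.1| <= r, `|x.1.2| <= r & `|x.2| <= r].
Proof. by rewrite normR3 !ge_max andbA. Qed.

(** Links the topology to the product sigma-algebra: U is the union of the half-open grid cubes of
    side 1/(n+1), over all n, that it contains, and these are countably many. *)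
Lemma open_measurableR3 (U : set (R3 R)) : open U -> measurable (U : set mR3).
Proof.
move=> oU.
pose fl n (t : R) : int := Num.floor (n.+1%:R * t).
pose cell (p : nat * (int * int * int)) : set mR3 :=
  [set x | [/\ fl p.1 x.1.1 = p.2.1.1, fl p.1 x.1.2 = p.2.1.2
             & fl p.1 x.2 = p.2.2]].
have mfl n k : measurable [set t : mR | fl n t = k].
  suff -> : [set t : mR | fl n t = k] =
     `[k%:~R / n.+1%:R, (k + 1)%:~R / n.+1%:R[%classic by [].
  apply/seteqP; split=> t /=; rewrite in_itv/= ler_pdivrMr// ltr_pdivlMr//.
    by rewrite mulrC => <-; exact: floor_itv.
  by rewrite mulrC; exact: floor_def.
have mcell p : measurable (cell p).
  have -> : cell p = ([set t | fl p.1 t = p.2.1.1] `*`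
     [set t | fl p.1 t = p.2.1.2]) `*` [set t | fl p.1 t = p.2.2].
    by apply/seteqP; split => [x [? ? ?]|x [[? ?] ?]].
  by apply: measurableX; first apply: measurableX.
have -> : U = \bigcup_p (if `[< cell p `<=` U >] then cell p else set0).
  apply/seteqP; split=> [x Ux|x [p _]]; last first.
    by case: asboolP => // pU; exact: pU.
  have /nbhs_ballP[r /= r0 rU] : nbhs x U by exact: open_nbhs_nbhs.
  have [n nr] : exists n, n.+1%:R^-1 < r.
    have [n nr] := ltr_add_invr r0; exists n; by rewrite add0r in nr.
  exists (n, (fl n x.1.1, fl n x.1.2, fl n x.2)) => //.
  case: asboolP => // -[] y [/= y1 y2 y3]; apply: rU.
  have close s t : fl n s = fl n t -> `|t - s| < r.
    move=> st; apply: le_lt_trans nr.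
    have /andP[s1 s2] := floor_itv (n.+1%:R * s).
    have /andP[t1 t2] := floor_itv (n.+1%:R * t).
    rewrite -/(fl n s) st /fl in s1 s2; rewrite intrD in s2 t2.
    rewrite -[leRHS]mul1r ler_pdivlMr// -[X in _ * X]normr_nat -normrM.
    rewrite mulrBl ![_ * n.+1%:R]mulrC ler_norml; lra.
  by rewrite prod_norm_ball/= normR3 !gt_max/= !close.
apply: countable_bigcupT_measurable => // p.
by case: ifPn => // _; exact: mcell.
Qed.

Lemma continuous_measurableR3 (f : R3 R -> R) :
  continuous f -> measurable_fun [set: mR3] f.
Proof.
move=> cf.
apply: (measurability _ (RGenOpens.measurableE R)).
move=> _ [_ [a [b ->] <-]]; rewrite setTI; apply: open_measurableR3.
by move: cf => /continuousP; apply; exact: interval_open.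
Qed.

Definition bounded_support (f : R3 R -> R) :=
  exists r, forall x, r < `|x| -> f x = 0.

Lemma bounded_integrable d (T : measurableType d)
    (mu : {measure set T -> \bar R}) (f : T -> R) (A : set T) (M : R) :
  measurable_fun setT f -> measurable A -> (mu A < +oo)%E ->
  (forall x, `|f x| <= M) -> (forall x, ~ A x -> f x = 0) ->
  mu.-integrable setT (EFin \o f).
Proof.
move=> mf mA Aoo fM fA; apply/integrableP; split; first exact/measurable_EFinP.
have [M0|M0] := ltP M 0.
  have f0 x : f x = 0.
    by apply/normr0_eq0/eqP; rewrite eq_le normr_ge0 (le_trans (fM x))// ltW.
  by rewrite (eq_integral (fun=> 0%E)) ?integral0 ?ltry// => x _;
    rewrite /= f0 normr0.
apply: (@le_lt_trans _ _ (\int[mu]_x (M%:E * (\1_A x)%:E))%E).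
  apply: ge0_le_integral => //.
  - by apply: measurableT_comp => //; exact/measurable_EFinP.
  - by apply: emeasurable_funM => //; apply/measurable_EFinP;
      exact: measurable_indic.
  move=> x _ /=; rewrite indicE; have [xA|xA] := boolP (x \in A).
    by rewrite mule1 lee_fin.
  by rewrite fA ?normr0 ?mule0// => /mem_set; exact/negP.
rewrite ge0_integralZl//; last by apply/measurable_EFinP; exact: measurable_indic.
by rewrite integral_indic// setIT lte_mul_pinfty.
Qed.

Lemma box_setX (r : R) : [set x : R3 R | `|x| <= r] =
  (`[- r, r]%classic `*` `[- r, r]%classic) `*` `[- r, r]%classic.
Proof.
apply/seteqP; split => x /=; rewrite normR3_le !ler_norml !in_itv/=.
  by case/and3P.
by case=> -[-> ->] ->.
Qed.

Lemma compact_box (r : R) : compact [set x : R3 R | `|x| <= r].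
Proof. by rewrite box_setX; do 2?[apply: compact_setX]; exact: segment_compact. Qed.

Lemma bounded_support_bounded (f : R3 R -> R) : continuous f ->
  bounded_support f -> exists2 M, 0 < M & forall x, `|f x| <= M.
Proof.
move=> cf [r fr].
have /(continuous_compact (continuous_subspaceT cf))/compact_bounded :
  compact [set x : R3 R | `|x| <= r] by exact: compact_box.
case=> M [_ /(_ (Num.max M 0 + 1))] /=.
have MM : M < Num.max M 0 + 1 by rewrite (@le_lt_trans _ _ (Num.max M 0)) ?le_max ?lexx// ltrDl.
have M0 : 0 < Num.max M 0 + 1 by rewrite ltr_wpDl// le_max lexx orbT.
move=> /(_ MM) H; exists (Num.max M 0 + 1) => // x.
have [xr|xr] := leP `|x| r; last by rewrite fr// normr0 ltW.
by apply: H; exists x.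
Qed.

Lemma measurable_box (r : R) : measurable ([set x | `|x| <= r] : set mR3).
Proof. by rewrite box_setX; apply: measurableX => //; apply: measurableX. Qed.

Lemma leb3X (A B C : set mR) : measurable A -> measurable B -> measurable C ->
  leb3 ((A `*` B) `*` C) = (leb A * leb B * leb C)%E.
Proof.
move=> mA mB mC; rewrite -[LHS]/((lebR3 : set mR3 -> \bar R) _).
rewrite product_measure1E//; last exact: measurableX.
congr (_ * _)%E; rewrite -[LHS]/((leb \x leb)%E _).
by rewrite product_measure1E.
Qed.

Lemma lebesgue_segment (r : R) : 0 <= r ->
  leb `[- r, r]%classic = (2 * r)%:E.
Proof.
move=> r0; rewrite lebesgue_measure_itv/= lte_fin.
case: ltP => rr; first by rewrite -EFinD; congr EFin; ring.
by have -> : r = 0 by [lra]; rewrite mulr0.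
Qed.

Lemma leb3_box (r : R) : 0 <= r ->
  leb3 [set x : R3 R | `|x| <= r] = ((2 * r) ^+ 3)%:E.
Proof.
move=> r0; rewrite box_setX leb3X// lebesgue_segment//.
by rewrite -!EFinM; congr EFin; ring.
Qed.

Lemma bounded_support_integrable (f : R3 R -> R) : continuous f ->
  bounded_support f -> leb3.-integrable setT (EFin \o f).
Proof.
move=> cf bf; have [M _ fM] := bounded_support_bounded cf bf.
have [r fr] := bf.
apply: (@bounded_integrable _ mR3 leb3 f [set x | `|x| <= Num.max r 0] M) => //.
- exact: continuous_measurableR3.
- exact: measurable_box.
- by rewrite leb3_box ?ltry// le_max lexx orbT.
- move=> x /negP; rewrite -ltNge => rx; apply: fr.
  by apply: le_lt_trans rx; rewrite le_max lexx.
Qed.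

Lemma bounded_support_derive (f : R3 R -> R) v : bounded_support f ->
  bounded_support ('D_v f).
Proof.
move=> [r fr]; exists r => x rx.
rewrite (near_eq_derive (g := cst 0)); first exact: derive_cst.
near=> y; apply: fr.
near: y.
have /= := @norm_continuous _ (R3 R) x.
by move/cvgr_gt; exact.
Unshelve. all: end_near. Qed.

Lemma integral_derive_line (g dg : R -> R) (r : R) :
  (forall t : R, is_derive t (1 : R) g (dg t)) -> continuous dg ->
  (forall t, r < `|t| -> g t = 0) -> (forall t, r < `|t| -> dg t = 0) ->
  (\int[leb]_t (dg t)%:E = 0)%E.
Proof.
move=> Dg cdg gr dgr.
(* Larger than r and positive: g vanishes at both endpoints and the segment [-s, s] is
   nondegenerate. *)
pose s := Num.max r 0 + 1.
have rs : r < s by rewrite (@le_lt_trans _ _ (Num.max r 0)) ?le_max ?lexx// ltrDl.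
have s0 : 0 < s by rewrite ltr_wpDl// le_max lexx orbT.
have -> : (\int[leb]_t (dg t)%:E = \int[leb]_(t in `[(- s)%R, s]) (dg t)%:E)%E.
  rewrite [RHS]integral_mkcond; apply: eq_integral => t _.
  rewrite patchE; case: ifPn => //; rewrite notin_setE/= in_itv/= => /negP.
  rewrite -ler_norml -ltNge => st; rewrite dgr//; exact: lt_trans st.
rewrite (continuous_FTC2 (F := g)).
- rewrite !gr ?subee// ?normrN gtr0_norm//.
- by rewrite gtrN.
- exact: continuous_subspaceT.
- have cg : continuous g.
    by move=> t; apply/differentiable_continuous/derivable1_diffP; case: (Dg t).
  split=> [x _||]; first by case: (Dg x).
    by apply: cvg_at_right_filter; exact: cg.
  by apply: cvg_at_left_filter; exact: cg.
- by move=> t _; rewrite derive1E; exact: derive_val.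
Qed.

Lemma lipschitz1_continuous (p : R -> R3 R) :
  (forall t s, `|p t - p s| <= `|t - s|) -> continuous p.
Proof.
move=> lp t; apply/cvgrPdist_lt => e e0; apply/nbhs_ballP; exists e => //= s.
by apply: le_lt_trans; exact: lp.
Qed.

Lemma continuous_coordR3 (x y z : R) :
  [/\ continuous (fun t : R => (t, y, z)), continuous (fun t : R => (x, t, z))
    & continuous (fun t : R => (x, y, t))].
Proof.
by split; apply: lipschitz1_continuous => t s;
  rewrite normR3/= !subrr normr0 !ge_max lexx normr_ge0.
Qed.

Lemma derive_line (f : R3 R -> R) (p : R -> R3 R) v (t : R) :
  (forall h, p (h + t) = h *: v + p t) -> derivable f (p t) v ->
  is_derive t (1 : R) (f \o p) ('D_v f (p t)).
Proof.
move=> pv df.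
have E : (fun h : R => h^-1 *: (((f \o p) \o shift t) (h *: (1 : R)) - (f \o p) t)) =
         (fun h : R => h^-1 *: ((f \o shift (p t)) (h *: v) - f (p t))).
  by apply/funext => h; rewrite /= /GRing.scale/= mulr1 pv.
by split; rewrite /derivable/derive E.
Qed.

Lemma measurable_sectionR3 (f : R3 R -> R) (z : mR) :
  continuous f -> measurable_fun setT (fun xy : mR * mR => f (xy, z)).
Proof.
move=> /continuous_measurableR3 mf.
exact: (measurable_fun_pair1 z mf).
Qed.

End Space.

(** * Fubini's theorem and integrals over space *)

Section Space2.
Context {R : realType}.
Notation leb := (@lebesgue_measure R).
Notation mR := (measurableTypeR R).
Notation mR3 := (mR * mR * mR)%type.

Definition leb2 : set (mR * mR) -> \bar R := (leb \x leb)%E.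
HB.instance Definition _ := Measure.on leb2.
HB.instance Definition _ :=
  Measure_isSigmaFinite.Build _ _ _ leb2 (product_sigma_finite leb leb).

(* [leb3] as a sigma-finite measure, which Fubini's theorem requires. *)
Definition leb3s : set mR3 -> \bar R := (leb2 \x leb)%E.
HB.instance Definition _ := Measure.on leb3s.
HB.instance Definition _ :=
  Measure_isSigmaFinite.Build _ _ _ leb3s (product_sigma_finite leb2 leb).

Lemma leb3_fubini12 (f : mR3 -> \bar R) : leb3.-integrable setT f ->
  (\int[leb3]_p f p = \int[leb2]_xy \int[leb]_z f (xy, z))%E.
Proof.
by move=> fi; exact: esym (@integral12_prod_meas1 _ _ _ _ R leb2 leb f fi).
Qed.

Lemma leb3_fubini21 (f : mR3 -> \bar R) : leb3.-integrable setT f ->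
  (\int[leb3]_p f p = \int[leb]_z \int[leb2]_xy f (xy, z))%E.
Proof.
by move=> fi; exact: esym (@integral21_prod_meas1 _ _ _ _ R leb2 leb f fi).
Qed.

Lemma leb2_fubini12 (f : mR * mR -> \bar R) : leb2.-integrable setT f ->
  (\int[leb2]_p f p = \int[leb]_x \int[leb]_y f (x, y))%E.
Proof.
by move=> fi; exact: esym (@integral12_prod_meas1 _ _ _ _ R leb leb f fi).
Qed.

Lemma leb2_fubini21 (f : mR * mR -> \bar R) : leb2.-integrable setT f ->
  (\int[leb2]_p f p = \int[leb]_y \int[leb]_x f (x, y))%E.
Proof.
by move=> fi; exact: esym (@integral21_prod_meas1 _ _ _ _ R leb leb f fi).
Qed.

Lemma scale_addR3 (h a b c x y z : R) :
  h *: ((a, b, c) : R3 R) + (x, y, z) = (h * a + x, h * b + y, h * c + z).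
Proof. by []. Qed.

(** Fubini's theorem is applied in the order that makes the j-th coordinate the innermost variable,
    where the fundamental theorem of calculus gives 0. All integrations by parts in frequency rest
    on this. *)
Lemma integral_derive0 (f : R3 R -> R) (j : 'I_3) : continuous f ->
  (forall x, derivable f x (Defs.basis j)) -> continuous ('D_(Defs.basis j) f) ->
  bounded_support f -> \int[leb3]_x 'D_(Defs.basis j) f x = 0.
Proof.
move=> cf df cdf bf; have bdf := bounded_support_derive (Defs.basis j) bf.
have [r1 fr1] := bf; have [r2 fr2] := bdf.
pose r := Num.max r1 r2.
have fr x : r < `|x| -> f x = 0.
  by move=> rx; apply: fr1; apply: le_lt_trans rx; rewrite le_max lexx.
have dfr x : r < `|x| -> 'D_(Defs.basis j) f x = 0.
  by move=> rx; apply: fr2; apply: le_lt_trans rx; rewrite le_max lexx orbT.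
have idf := bounded_support_integrable cdf bdf.
have line (p : R -> R3 R) : continuous p -> (forall t, `|t| <= `|p t|) ->
    (forall t h, p (h + t) = h *: Defs.basis j + p t) ->
    (\int[leb]_t ('D_(Defs.basis j) f (p t))%:E = 0)%E.
  move=> cp tp pj; apply: (integral_derive_line (g := f \o p) (r := r)).
  - by move=> t; apply: derive_line => // h; exact: pj.
  - have c : continuous ('D_(Defs.basis j) f \o p).
      by move=> t; apply: continuous_comp; [exact: cp|exact: cdf].
    exact: c.
  - by move=> t rt; apply: fr; exact: lt_le_trans (tp t).
  - by move=> t rt; apply: dfr; exact: lt_le_trans (tp t).
have [M _ dfM] := bounded_support_bounded cdf bdf.
have isec z : leb2.-integrable setT
    (EFin \o (fun xy : mR * mR => 'D_(Defs.basis j) f (xy, z))).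
  pose s := Num.max r 0.
  apply: (@bounded_integrable R _ (mR * mR)%type leb2 _
    (`[- s, s]%classic `*` `[- s, s]%classic) M) => //.
  - exact: (measurable_sectionR3 z cdf).
  - exact: measurableX.
  - rewrite -[X in (X < _)%E]/((leb \x leb)%E _) product_measure1E//.
    rewrite -[X in (X < _)%E]/(leb `[(- s)%R, s]%classic * leb `[(- s)%R, s]%classic)%E.
    by rewrite lebesgue_segment ?le_max ?lexx ?orbT// -EFinM ltry.
  - move=> [x y] /= xy; apply: dfr; rewrite ltNge; apply/negP.
    rewrite normR3_le/= => /and3P[x1 y1 _]; apply: xy.
    by rewrite !in_itv/= -!ler_norml; split; rewrite le_max ?x1 ?y1.
rewrite /Rintegral; apply/eqP; rewrite fine_eq0; last first.
  by apply: integrable_fin_num.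
apply/eqP.
case: j df cdf bdf fr2 dfr idf line dfM isec => -[|[|[|//]]] jlt df cdf bdf fr2 dfr idf line dfM isec.
- transitivity (\int[leb]_z \int[leb2]_xy ('D_(Defs.basis (Ordinal jlt)) f (xy, z))%:E)%E.
    exact: leb3_fubini21 idf.
  apply: integral0_eq => z _.
  transitivity (\int[leb]_y \int[leb]_x ('D_(Defs.basis (Ordinal jlt)) f (x, y, z))%:E)%E.
    exact: leb2_fubini21 (isec z).
  apply: integral0_eq => y _.
  apply: (line (fun t => (t, y, z))).
    by case: (continuous_coordR3 0 y z).
    by move=> t; rewrite normR3/= !le_max lexx.
  by move=> t h; rewrite /Defs.basis scale_addR3/= ?mulr1 ?mulr0 ?add0r.
- transitivity (\int[leb]_z \int[leb2]_xy ('D_(Defs.basis (Ordinal jlt)) f (xy, z))%:E)%E.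
    exact: leb3_fubini21 idf.
  apply: integral0_eq => z _.
  transitivity (\int[leb]_x \int[leb]_y ('D_(Defs.basis (Ordinal jlt)) f (x, y, z))%:E)%E.
    exact: leb2_fubini12 (isec z).
  apply: integral0_eq => x _.
  apply: (line (fun t => (x, t, z))).
    by case: (continuous_coordR3 x 0 z).
    by move=> t; rewrite normR3/= !le_max lexx orbT.
  by move=> t h; rewrite /Defs.basis scale_addR3/= ?mulr1 ?mulr0 ?add0r.
- transitivity (\int[leb2]_xy \int[leb]_z ('D_(Defs.basis (Ordinal jlt)) f (xy, z))%:E)%E.
    exact: leb3_fubini12 idf.
  apply: integral0_eq => -[x y] _.
  apply: (line (fun t => (x, y, t))).
    by case: (continuous_coordR3 x y 0).
    by move=> t; rewrite normR3/= !le_max lexx !orbT.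
  by move=> t h; rewrite /Defs.basis scale_addR3/= ?mulr1 ?mulr0 ?add0r.
Qed.

(** The substitution y -> (y - x) / a reduces to the integral of 1 / (1 + y^2), which is twice its
    half-line value pi / 2. *)
Lemma integral_cauchy1 (x a : R) : 0 < a ->
  (\int[leb]_y ((1 + (a^-1 * (y - x)) ^+ 2)^-1)%:E = (a * pi)%:E)%E.
Proof.
move=> a0.
have I0 : (\int[leb]_y (oneDsqr y)^-1%:E = pi%:E)%E.
  rewrite ge0_symfun_integralT; last 3 first.
  - by move=> y; rewrite invr_ge0.
  - exact: continuous_oneDsqrV.
  - by move=> y /=; rewrite /oneDsqr sqrrN.
  rewrite -set_itvcy integral0y_oneDsqr -EFinM; congr EFin.
  by rewrite mulrCA mulfV ?mulr1.
pose F (y : R) := a^-1 * (y - x).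
have dF y : is_derive y (1 : R) F a^-1.
  rewrite /F; apply: is_derive_eq; rewrite subr0 /GRing.scale/= ?mulr1//.
have F' : F^`()%classic = cst a^-1.
  by apply/funext => y; rewrite derive1E; exact: derive_val.
have FE : (fun y => (oneDsqr y)^-1) \o F = fun y => (1 + (a^-1 * (y - x)) ^+ 2)^-1.
  by [].
have mF : measurable_fun [set: R] (fun y : R => (1 + (a^-1 * (y - x)) ^+ 2)^-1).
  rewrite -FE; apply: measurableT_comp.
    by apply: continuous_measurable_fun; exact: continuous_oneDsqrV.
  by apply: measurable_funM => //; exact: measurable_funB.
have -> : (a * pi)%:E = (a%:E * \int[leb]_y ((((fun y => (oneDsqr y)^-1) \o F) * F^`()%classic) y)%:E)%E.
  rewrite EFinM -I0; congr (_ * _)%E.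
  apply: increasing_ge0_integration_by_substitutionT.
  - by move=> u v uv; rewrite /F ltr_pM2l ?invr_gt0// ltrD2r.
  - by rewrite F' => y; exact: cvg_cst.
  - by rewrite F'; exact: is_cvg_cst.
  - by rewrite F'; exact: is_cvg_cst.
  - by move=> y; case: (dF y).
  - apply/cvgrNyPle => A; near=> y.
    rewrite /F mulrC ler_pdivrMr// lerBlDr; near: y.
    by apply: nbhs_ninfty_le; exact: num_real.
  - apply/cvgryPge => A; near=> y.
    rewrite /F mulrC ler_pdivlMr// lerBrDr; near: y.
    by apply: nbhs_pinfty_ge; exact: num_real.
  - exact: continuous_oneDsqrV.
  - by move=> y; rewrite invr_ge0.
rewrite -ge0_integralZl//; last 3 first.
- apply/measurable_EFinP; rewrite F' FE; exact: measurable_funM.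
- move=> y _; rewrite lee_fin F' FE/= mulr_ge0// ?invr_ge0 ?addr_ge0 ?sqr_ge0//.
  exact: ltW.
- by rewrite lee_fin ltW.
apply: eq_integral => y _.
by rewrite F' /= -EFinM mulrCA mulfV ?mulr1// gt_eqF.
Unshelve. all: end_near. Qed.

End Space2.

(** * Oscillatory integrals *)

Section Oscillatory.
Context {R : realType}.
Implicit Types (x y v xi : R3 R) (psi f : R3 R -> R) (th a : R).

Lemma dotC x y : dot x y = dot y x.
Proof. by rewrite /dot (mulrC x.1.1) (mulrC x.1.2) (mulrC x.2). Qed.

Lemma dotDl x y xi : dot (x + y) xi = dot x xi + dot y xi.
Proof. by rewrite /dot/=; ring. Qed.

Lemma dotZl a x xi : dot (a *: x) xi = a * dot x xi.
Proof. by rewrite /dot/= /GRing.scale/=; ring. Qed.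

Lemma dotNl x xi : dot (- x) xi = - dot x xi.
Proof. by rewrite /dot/=; ring. Qed.

Lemma dotBl x y xi : dot (x - y) xi = dot x xi - dot y xi.
Proof. by rewrite dotDl dotNl. Qed.

Lemma dot_le x y : `|dot x y| <= 3 * (`|x| * `|y|).
Proof.
have [/and3P[x1 x2 x3] /and3P[y1 y2 y3]] :
  [&& `|x.1.1| <= `|x|, `|x.1.2| <= `|x| & `|x.2| <= `|x| ] /\
  [&& `|y.1.1| <= `|y|, `|y.1.2| <= `|y| & `|y.2| <= `|y| ].
  by rewrite -!normR3_le !lexx.
have -> : 3 * (`|x| * `|y|) = `|x| * `|y| + `|x| * `|y| + `|x| * `|y| by ring.
apply: le_trans (ler_normD _ _) _; apply: lerD; last by rewrite normrM ler_pM.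
by apply: le_trans (ler_normD _ _) _; apply: lerD; rewrite normrM ler_pM.
Qed.

Lemma lipschitz_continuous {V : normedModType R} (f : V -> R) (k : R) :
  (forall x y : V, `|f x - f y| <= k * `|x - y|) -> continuous f.
Proof.
move=> lf x; apply/cvgrPdist_lt => e e0; apply/nbhs_ballP.
have k0 : 0 < `|k| + 1 by rewrite ltr_wpDl.
exists (e / (`|k| + 1)); first by rewrite /= divr_gt0.
move=> y; rewrite -ball_normE/= ltr_pdivlMr// mulrC => xy.
apply: le_lt_trans (lf x y) _; apply: le_lt_trans xy.
by rewrite ler_wpM2r// (le_trans (ler_norm k))// lerDl.
Qed.

Lemma continuous_dot x : continuous (dot x).
Proof.
apply: (@lipschitz_continuous _ _ (3 * `|x|)) => y z.
by rewrite !(dotC x) -dotBl dotC -mulrA; exact: dot_le.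
Qed.

Lemma is_derive_line {V : normedModType R} (f : V -> R) (x v : V) (l : R) :
  is_derive (0 : R) (1 : R) (fun h : R => f (h *: v + x)) l ->
  is_derive x v f l.
Proof.
case=> df fl; split; first exact/derivable1P.
rewrite -fl /derive; set g1 := fun h => _; set g2 := fun h => _.
suff -> : g1 = g2 by [].
by apply/funext => h; rewrite /g1 /g2/= addr0 scale0r add0r [_%:A]mulr1.
Qed.

Lemma is_derive_dot x xi v : is_derive xi v (dot x) (dot x v).
Proof.
apply: is_derive_line.
have -> : (fun h : R => dot x (h *: v + xi)) = (fun h => h * dot x v + dot x xi).
  by apply/funext => h; rewrite dotC dotDl dotZl !(dotC _ x).
by apply: is_derive_eq; rewrite addr0 scaler0 add0r [_ *: _]mulr1.
Qed.

Lemma smooth_dot x : smooth (dot x).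
Proof.
apply/smoothP => -[|n]; first by split => //; exact: continuous_dot.
split; first exact: continuous_dot.
move=> v; split; first by move=> xi; case: (is_derive_dot x xi v).
suff -> : 'D_v (dot x) = cst (dot x v) by exact: Ck_cst.
by apply/funext => xi; case: (is_derive_dot x xi v).
Qed.

Lemma continuous_cos_dot x th : continuous (fun xi => cos (dot x xi + th)).
Proof.
move=> xi; apply: (@continuous_comp _ _ _ (fun xi => dot x xi + th) cos).
  by apply: cvgD; [exact: continuous_dot|exact: cvg_cst].
exact: continuous_cos.
Qed.

Lemma is_derive_cos_dot x th xi v :
  is_derive xi v (fun xi => cos (dot x xi + th)) (- (dot x v * sin (dot x xi + th))).
Proof.
apply: is_derive_line.
have -> : (fun h : R => cos (dot x (h *: v + xi) + th)) =
    cos \o (fun h => h * dot x v + (dot x xi + th)).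
  by apply/funext => h /=; rewrite dotC dotDl dotZl !(dotC _ x) -addrA.
apply: is_derive_eq.
by rewrite mul0r !(addr0, scaler0, add0r) /GRing.scale/= mulr1; ring.
Qed.

(** The phase [th] unifies cosine and sine integrals: differentiation in x shifts it by pi / 2, so
    the class is stable under derivatives. Phase 0 is the real part of the Fourier integral. *)
Definition osc psi th x : R :=
  \int[leb3]_xi (psi xi * cos (dot x xi + th)).

Lemma osc_integrable psi th x : continuous psi -> bounded_support psi ->
  leb3.-integrable setT (EFin \o (fun xi => psi xi * cos (dot x xi + th))).
Proof.
move=> cpsi [r psir]; apply: bounded_support_integrable.
  move=> xi; apply: cvgM; first exact: cpsi.
  exact: continuous_cos_dot.
by exists r => xi /psir ->; rewrite mul0r.
Qed.

Lemma bounded_supportM psi f : bounded_support psi ->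
  bounded_support (fun x => psi x * f x).
Proof. by move=> [r psir]; exists r => x /psir ->; rewrite mul0r. Qed.

Lemma bounded_supportMl psi f : bounded_support psi ->
  bounded_support (fun x => f x * psi x).
Proof. by move=> [r psir]; exists r => x /psir ->; rewrite mulr0. Qed.

Lemma bounded_supportD psi f : bounded_support psi -> bounded_support f ->
  bounded_support (fun x => psi x + f x).
Proof.
move=> [r psir] [s fs]; exists (Num.max r s) => x; rewrite gt_max => /andP[rx sx].
by rewrite psir// fs// addr0.
Qed.

Lemma continuousM_R3 psi f : continuous psi -> continuous f ->
  continuous (fun x => psi x * f x).
Proof. by move=> cp cf x; apply: cvgM; [exact: cp|exact: cf]. Qed.

Lemma integrable_abs_bounded_support psi : continuous psi ->
  bounded_support psi -> leb3.-integrable setT (EFin \o (fun xi => `|psi xi|)).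
Proof.
move=> cpsi [r psir]; apply: bounded_support_integrable.
  by move=> x; apply: cvg_norm; exact: cpsi.
by exists r => x /psir ->; rewrite normr0.
Qed.

Lemma osc_norm_le psi th x : continuous psi -> bounded_support psi ->
  `|osc psi th x| <= \int[leb3]_xi `|psi xi|.
Proof.
move=> cpsi bpsi; apply: (le_trans (le_normr_Rintegral _ _)) => //.
  exact: osc_integrable.
apply: le_Rintegral => //.
- apply: integrable_abs_bounded_support; last exact: bounded_supportM.
  by apply: continuousM_R3 => //; exact: continuous_cos_dot.
- exact: integrable_abs_bounded_support.
by move=> xi _; rewrite normrM ler_piMr// ler_norml cos_geN1 cos_le1.
Qed.

Lemma cos_lipschitz (s t : R) : `|cos s - cos t| <= `|s - t|.
Proof.
wlog st : s t / t <= s.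
  move=> H; have [/H//|/ltW/H] := leP t s.
  by rewrite distrC (distrC t).
have [c _ ->] := @MVT_segment R cos (fun u => - sin u) t s st
  (fun u _ => is_derive_cos u) (continuous_subspaceT (@continuous_cos R)).
by rewrite normrM normrN ler_piMl// ler_norml sin_geN1 sin_le1.
Qed.

Lemma continuous_osc psi th : continuous psi -> bounded_support psi ->
  continuous (osc psi th).
Proof.
move=> cpsi bpsi.
pose k xi := 3 * (`|xi| * `|psi xi|).
have ik : leb3.-integrable setT (EFin \o k).
  apply: bounded_support_integrable.
    move=> x; apply: cvgM; first exact: cvg_cst.
    by apply: cvgM; apply: cvg_norm; [exact: cvg_id|exact: cpsi].
  case: bpsi => r psir; exists r => x /psir.
  by rewrite /k => ->; rewrite normr0 !mulr0.
apply: (@lipschitz_continuous _ _ (\int[leb3]_xi k xi)) => x y.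
rewrite /osc -RintegralB//; try exact: osc_integrable.
apply: (le_trans (le_normr_Rintegral _ _)) => //.
  have := integrableB measurableT (osc_integrable th x cpsi bpsi)
    (osc_integrable th y cpsi bpsi).
  by [].
rewrite mulrC -RintegralZl//.
apply: le_Rintegral => //.
- apply: integrable_abs_bounded_support.
    move=> xi; apply: cvgB.
      by apply: continuousM_R3 => //; exact: continuous_cos_dot.
    by apply: continuousM_R3 => //; exact: continuous_cos_dot.
  case: bpsi => r psir; exists r => xi /psir ->.
  by rewrite !mul0r subrr.
- have := integrableZl measurableT `|x - y| ik.
  by [].
move=> xi _; rewrite -mulrBr normrM /k.
apply: (@le_trans _ _ (`|psi xi| * (3 * (`|x - y| * `|xi|)))); last first.
  by rewrite le_eqVlt; apply/orP; left; apply/eqP; ring.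
rewrite ler_wpM2l//; apply: le_trans (cos_lipschitz _ _) _.
by rewrite opprD addrACA subrr addr0 -dotBl; exact: dot_le.
Qed.

Lemma continuous_dotM v psi : continuous psi ->
  continuous (fun xi => dot v xi * psi xi).
Proof. by move=> cp; apply: continuousM_R3 => //; exact: continuous_dot. Qed.

(** Differentiation under the integral sign along the line [h *: v + x], dominated for all h by
    |v.xi| |psi xi|. The resulting - sin is the cosine with phase advanced by pi / 2. *)
Lemma is_derive_osc psi th x v : continuous psi -> bounded_support psi ->
  is_derive x v (osc psi th) (osc (fun xi => dot v xi * psi xi) (th + pi / 2) x).
Proof.
move=> cpsi bpsi; apply: is_derive_line.
pose f (h : R) xi := psi xi * cos (dot (h *: v + x) xi + th).
have df (h : R) xi : is_derive h (1 : R) (f ^~ xi)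
    (- psi xi * dot v xi * sin (dot (h *: v + x) xi + th)).
  have -> : f ^~ xi = psi xi \*: (cos \o (fun h => h * dot v xi + (dot x xi + th))).
    by apply/funext => k; rewrite /f/= dotDl dotZl -addrA.
  apply: is_derive_eq.
  rewrite dotDl dotZl -(addrA (h * dot v xi)).
  by rewrite !(addr0, scaler0, add0r) /GRing.scale/= mulr1; ring.
have cdpsi := continuous_dotM (v := v) cpsi.
have bdpsi : bounded_support (fun xi => dot v xi * psi xi) by exact: bounded_supportMl.
have H := @cvg_differentiation_under_integral R _ _ leb3 f setT measurableT
  0 (-1) 1 _ _ _ (fun xi => `|dot v xi * psi xi|) _ _ _.
suff K : h^-1 *: (osc psi th ((h + 0) *: v + x) - osc psi th (0 *: v + x)) @[h --> 0^'] -->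
    osc (fun xi => dot v xi * psi xi) (th + pi / 2) x.
  suff E : (fun h : R => h^-1 *: (((fun h => osc psi th (h *: v + x)) \o shift 0) (h *: (1 : R)) -
             osc psi th (0 *: v + x))) =
      (fun h : R => h^-1 *: (osc psi th ((h + 0) *: v + x) - osc psi th (0 *: v + x))).
    split; rewrite /derivable/derive E; [apply/cvg_ex; eexists; exact: K|exact: cvg_lim K].
  by apply/funext => h /=; rewrite [_%:A]mulr1.
have -> : osc (fun xi => dot v xi * psi xi) (th + pi / 2) x =
    \int[leb3]_(xi in setT) partial1of2 f 0 xi.
  apply: eq_Rintegral => xi _; rewrite /partial1of2 derive1E.
  have [_ ->] := df 0 xi.
  rewrite scale0r add0r addrA cosDpihalf; ring.
apply: H.
- by rewrite /= in_itv/= ltrN10 ltr01.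
- by move=> h _; exact: osc_integrable.
- by move=> h xi _ _; case: (df h xi).
- by [].
- exact: integrable_abs_bounded_support.
- move=> h xi _ _; rewrite /partial1of2 derive1E.
  have [_ ->] := df h xi.
  rewrite !normrM normrN (mulrC `|psi xi|) ler_piMr// ?mulr_ge0//.
  by rewrite ler_norml sin_geN1 sin_le1.
Qed.

Lemma smooth_osc psi th : continuous psi -> bounded_support psi ->
  smooth (osc psi th).
Proof.
move=> cpsi bpsi; apply/smoothP => n.
elim: n psi th cpsi bpsi => [|n IH] psi th cpsi bpsi.
  by split => //; exact: continuous_osc.
split; first exact: continuous_osc.
move=> v; split; first by move=> x; case: (is_derive_osc th x v cpsi bpsi).
have -> : 'D_v (osc psi th) = osc (fun xi => dot v xi * psi xi) (th + pi / 2).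
  by apply/funext => x; case: (is_derive_osc th x v cpsi bpsi).
by apply: IH; [exact: continuous_dotM|exact: bounded_supportMl].
Qed.

(** The j-th derivative of psi(xi) cos(x.xi + th) has integral 0, psi having bounded support.
    Differentiating the cosine brings out - x_j sin, and this sine is the cosine of phase
    [th - pi / 2]. *)
Lemma osc_parts psi th x j : smooth psi -> bounded_support psi ->
  dot x (Defs.basis j) * osc psi (th - pi / 2) x =
  osc ('D_(Defs.basis j) psi) th x.
Proof.
move=> spsi bpsi; set e := Defs.basis j.
have cpsi := smooth_continuous spsi.
have cdpsi := smooth_continuous (smooth_derive e spsi).
have bdpsi := bounded_support_derive e bpsi.
pose g xi := cos (dot x xi + th).
pose F xi := psi xi * g xi.
have dF xi : is_derive xi e F
   ('D_e psi xi * g xi - psi xi * cos (dot x xi + (th - pi / 2)) * dot x e).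
  have dg := is_derive_cos_dot x th xi e.
  have dp := derivableP (smooth_derivable (x := xi) (v := e) spsi).
  apply: is_derive_eq.
  by rewrite /GRing.scale/= addrA cosBpihalf; ring.
have DF : 'D_e F = fun xi => 'D_e psi xi * g xi -
    dot x e * (psi xi * cos (dot x xi + (th - pi / 2))).
  by apply/funext => xi; have [_ ->] := dF xi; rewrite [X in _ = _ - X]mulrC.
have c1 : continuous (fun xi => 'D_e psi xi * g xi).
  by apply: continuousM_R3 => //; exact: continuous_cos_dot.
have c2 : continuous (fun xi => psi xi * cos (dot x xi + (th - pi / 2))).
  by apply: continuousM_R3 => //; exact: continuous_cos_dot.
have cdF : continuous ('D_e F).
  by rewrite DF => xi; apply: cvgB; [exact: c1|apply: cvgM; [exact: cvg_cst|exact: c2]].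
have : \int[leb3]_xi 'D_e F xi = 0.
  apply: integral_derive0 => //.
  - by apply: continuousM_R3 => //; exact: continuous_cos_dot.
  - exact: bounded_supportM.
rewrite DF RintegralB//; last 2 first.
- exact: osc_integrable.
- have := integrableZl measurableT (dot x e) (osc_integrable (th - pi / 2) x cpsi bpsi).
  by [].
rewrite RintegralZl//; last exact: osc_integrable.
by move/eqP; rewrite subr_eq0 => /eqP/esym.
Qed.

Definition scaled a psi : R3 R -> R := fun xi => psi (a *: xi).

Lemma scaled_affine a psi : scaled a psi = fun y => psi (0 + a *: y).
Proof. by apply/funext => y; rewrite add0r. Qed.

Lemma smooth_scaled a psi : smooth psi -> smooth (scaled a psi).
Proof. by rewrite scaled_affine; exact: smooth_affine. Qed.

Lemma derive_scaled a psi v : smooth psi ->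
  'D_v (scaled a psi) = fun xi => a * scaled a ('D_v psi) xi.
Proof.
move=> spsi; apply/funext => xi; rewrite scaled_affine derive_affine add0r.
have [_ ->] := @derive_scale _ _ psi a v (a *: xi) (smooth_derivable (x := a *: xi) (v := v) spsi).
by [].
Qed.

Lemma bounded_support_scaled a psi : 0 < a -> bounded_support psi ->
  bounded_support (scaled a psi).
Proof.
move=> a0 [r psir]; exists (a^-1 * r) => xi rxi; apply: psir.
by rewrite prod_norm_scale gtr0_norm// -ltr_pdivrMl.
Qed.

(** The one-dimensional operator 1 - D_j^2, which becomes multiplication by 1 + x_j^2 after Fourier
    integration. *)
Definition helmholtz (j : 'I_3) psi : R3 R -> R :=
  fun xi => psi xi - 'D_(Defs.basis j) ('D_(Defs.basis j) psi) xi.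

Lemma smooth_helmholtz j psi : smooth psi -> smooth (helmholtz j psi).
Proof.
by move=> spsi; exact: (smoothB spsi (smooth_derive _ (smooth_derive _ spsi))).
Qed.

Lemma bounded_supportN psi : bounded_support psi ->
  bounded_support (fun x => - psi x).
Proof. by move=> [r psir]; exists r => x /psir ->; rewrite oppr0. Qed.

Lemma bounded_support_helmholtz j psi : bounded_support psi ->
  bounded_support (helmholtz j psi).
Proof.
move=> bpsi; apply: bounded_supportD => //; apply: bounded_supportN.
by do 2!apply: bounded_support_derive.
Qed.

Lemma oscZ c psi th x : continuous psi -> bounded_support psi ->
  osc (fun xi => c * psi xi) th x = c * osc psi th x.
Proof.
move=> cpsi bpsi; rewrite /osc -RintegralZl//; last exact: osc_integrable.
by apply: eq_Rintegral => xi _; rewrite mulrA.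
Qed.

(** Two integrations by parts. Each derivative of [scaled a psi] brings out a factor a, which is why
    x_j appears divided by a. *)
Lemma osc_helmholtz_scaled j a psi th x : 0 < a -> smooth psi ->
  bounded_support psi ->
  (1 + (a^-1 * dot x (Defs.basis j)) ^+ 2) * osc (scaled a psi) th x =
  osc (scaled a (helmholtz j psi)) th x.
Proof.
move=> a0 spsi bpsi; set e := Defs.basis j; set k := dot x e.
have sd := smooth_derive e spsi; have bd := bounded_support_derive e bpsi.
have sdd := smooth_derive e sd; have bdd := bounded_support_derive e bd.
have ss := smooth_scaled a spsi; have bs := bounded_support_scaled a0 bpsi.
have ssd := smooth_scaled a sd; have bsd := bounded_support_scaled a0 bd.
have ssdd := smooth_scaled a sdd; have bsdd := bounded_support_scaled a0 bdd.
have P1 := osc_parts (th - pi / 2) x j ss bs.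
have P2 := osc_parts th x j ssd bsd.
rewrite -/e -/k (derive_scaled _ _ spsi) (oscZ _ _ _ (smooth_continuous ssd) bsd) in P1.
rewrite -/e -/k (derive_scaled _ _ sd) (oscZ _ _ _ (smooth_continuous ssdd) bsdd) in P2.
(* Two shifts by pi / 2 amount to a change of sign; this turns - D_j^2 into + x_j^2. *)
have E : osc (scaled a psi) (th - pi / 2 - pi / 2) x = - osc (scaled a psi) th x.
  rewrite -[RHS]mulN1r -(oscZ _ _ _ (smooth_continuous ss) bs).
  by apply: eq_Rintegral => xi _; rewrite !addrA !cosBpihalf sinBpihalf mulN1r mulNr mulrN.
rewrite E in P1.
have -> : osc (scaled a (helmholtz j psi)) th x = osc (scaled a psi) th x -
    osc (scaled a ('D_e ('D_e psi))) th x.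
  rewrite /osc -RintegralB//; last 2 first.
  - by apply: osc_integrable => //; exact: smooth_continuous.
  - by apply: osc_integrable => //; exact: smooth_continuous.
  by apply: eq_Rintegral => xi _; rewrite -mulrBl.
have a1 : a != 0 by rewrite gt_eqF.
have -> : osc (scaled a ('D_e ('D_e psi))) th x = - ((a^-1 * k) ^+ 2 * osc (scaled a psi) th x).
  apply: (mulfI a1); rewrite -P2.
  have -> : osc (scaled a ('D_e psi)) (th - pi / 2) x = - (a^-1 * k * osc (scaled a psi) th x).
    by apply: (mulfI a1); rewrite -P1 mulrN mulrN !mulrA mulfV// mul1r.
  by rewrite expr2 !mulrN -!mulrA; congr (- _); rewrite mulrCA !mulrA mulfV// mul1r.
by ring.
Qed.

Lemma osc_scaled_bound psi : continuous psi -> bounded_support psi ->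
  exists2 C, 0 < C & forall a th x, 0 < a -> `|osc (scaled a psi) th x| <= C / a ^+ 3.
Proof.
move=> cpsi bpsi; have [M M0 psiM] := bounded_support_bounded cpsi bpsi.
have [r psir] := bpsi; pose s := Num.max r 0 + 1.
have s0 : 0 < s by rewrite ltr_wpDl// le_max lexx orbT.
(* The integrand is at most M, and vanishes outside a box of side 2 s / a. *)
exists (M * (2 * s) ^+ 3); first by rewrite mulr_gt0// exprn_gt0// mulr_gt0.
move=> a th x a0.
have cs : continuous (scaled a psi).
  move=> xi; apply: (@continuous_comp _ _ _ (fun xi => a *: xi) psi).
    by apply: cvgZ; [exact: cvg_cst|exact: cvg_id].
  exact: cpsi.
have bs := bounded_support_scaled a0 bpsi.
apply: (le_trans (osc_norm_le th x cs bs)).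
rewrite -lee_fin fineK; last first.
  by apply: integrable_fin_num => //; exact: integrable_abs_bounded_support.
pose B := [set xi : R3 R | `|xi| <= s / a].
apply: (@le_trans _ _ (\int[leb3]_xi (M%:E * (\1_B xi)%:E))%E).
  apply: ge0_le_integral => //.
  - have /measurable_int := integrable_abs_bounded_support cs bs.
    by [].
  - by apply/measurable_EFinP; apply: measurable_funM => //; apply: measurable_indic; exact: measurable_box.
  move=> xi _; rewrite -EFinM lee_fin indicE; have [xB|xB] := boolP (xi \in B).
    by rewrite mulr1; exact: psiM.
  rewrite mulr0 /scaled psir ?normr0//.
  move: xB; rewrite notin_setE/= => /negP; rewrite -ltNge.
  rewrite prod_norm_scale gtr0_norm// ltr_pdivrMr// mulrC; apply: lt_trans.
  by rewrite (@le_lt_trans _ _ (Num.max r 0)) ?le_max ?lexx// ltrDl.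
rewrite ge0_integralZl//; last 2 first.
- by apply/measurable_EFinP; apply: measurable_indic; exact: measurable_box.
- by rewrite lee_fin ltW.
rewrite integral_indic ?setIT//; last exact: measurable_box.
rewrite leb3_box ?divr_ge0 ?(ltW a0) ?(ltW s0)// -EFinM lee_fin.
by rewrite !exprMn exprVn !mulrA lexx.
Qed.

(** Left unnormalized, with integral pi^3: the maximum is then 1, so that the function dominates its
    own square. *)
Definition cauchy3 x : R :=
  ((1 + x.1.1 ^+ 2) * (1 + x.1.2 ^+ 2) * (1 + x.2 ^+ 2))^-1.

(** Applying [helmholtz] in the three coordinates multiplies the integral by 1 /
    [cauchy3 (a^-1 *: x)], so the uniform bound for the function obtained in this way is already the
    decay of the original integral. *)
Lemma osc_scaled_decay psi : smooth psi -> bounded_support psi ->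
  exists2 C, 0 < C & forall a th x, 0 < a ->
    `|osc (scaled a psi) th x| <= C / a ^+ 3 * cauchy3 (a^-1 *: x).
Proof.
move=> spsi bpsi.
have s1 := smooth_helmholtz (inord 0) spsi.
have b1 := bounded_support_helmholtz (inord 0) bpsi.
have s2 := smooth_helmholtz (inord 1) s1.
have b2 := bounded_support_helmholtz (inord 1) b1.
have s3 := smooth_helmholtz (inord 2) s2.
have b3 := bounded_support_helmholtz (inord 2) b2.
have [C C0 HC] := osc_scaled_bound (smooth_continuous s3) b3.
exists C => // a th x a0.
have E1 := osc_helmholtz_scaled (inord 0) th x a0 spsi bpsi.
have E2 := osc_helmholtz_scaled (inord 1) th x a0 s1 b1.
have E3 := osc_helmholtz_scaled (inord 2) th x a0 s2 b2.
have := HC a th x a0; rewrite -E3 -E2 -E1.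
have -> : dot x (Defs.basis (inord 0)) = x.1.1.
  by rewrite /dot/Defs.basis inordK//= mulr1 !mulr0 !addr0.
have -> : dot x (Defs.basis (inord 1)) = x.1.2.
  by rewrite /dot/Defs.basis inordK//= mulr1 !mulr0 addr0 add0r.
have -> : dot x (Defs.basis (inord 2)) = x.2.
  by rewrite /dot/Defs.basis inordK//= mulr1 !mulr0 !add0r.
have pos (t : R) : 0 < 1 + t ^+ 2 by rewrite ltr_pwDl// sqr_ge0.
rewrite !normrM !(gtr0_norm (pos _)) => H.
rewrite /cauchy3 ler_pdivlMr ?mulr_gt0//; apply: le_trans H; rewrite le_eqVlt; apply/orP; left; apply/eqP.
rewrite /= /GRing.scale/=; ring.
Qed.

End Oscillatory.

(** * Integrals of nonmeasurable functions *)

Section LowerIntegral.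
Context d (T : measurableType d) {R : realType}.
Variable mu : {measure set T -> \bar R}.
Local Open Scope ereal_scope.
Import HBNNSimple.

(* The integral of a nonnegative function is a supremum over the simple
   functions below it, so it is monotone without any measurability. *)
Lemma ae_le_integral (D : set T) (f g : T -> \bar R) :
  (forall x, D x -> 0 <= f x) -> (forall x, D x -> 0 <= g x) ->
  {ae mu, forall x, D x -> f x <= g x} ->
  \int[mu]_(x in D) f x <= \int[mu]_(x in D) g x.
Proof.
move=> f0 g0 [N [mN N0 fgN]]; rewrite !ge0_integralE//.
apply: ge_ereal_sup => _ [h /= hf <-].
pose h' := mul_nnsfun h (indic_nnsfun R (measurableC mN)).
have -> : sintegral mu h = sintegral mu h'.
  rewrite -!integralT_nnsfun; apply: ge0_ae_eq_integral => //;
    try (by move=> x _; rewrite lee_fin); try exact/measurable_EFinP.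
  exists N; split => // x /= hx; apply: contrapT => Nx; apply: hx => _.
  by rewrite /h'/= /mindic indicE mem_set// mulr1.
apply: ereal_sup_ubound; exists h' => //= x.
rewrite /mindic indicE; have [xN|xN] := boolP (x \in ~` N).
  rewrite mulr1; apply: (le_trans (hf x)).
  rewrite /patch; case: ifPn => // /set_mem Dx.
  apply: contrapT => fg; move/set_mem: xN; apply; apply: fgN => /= /(_ Dx).
  exact: fg.
rewrite mulr0 /patch; case: ifPn => // /set_mem Dx; exact: g0.
Qed.

Lemma ge0_le_lower_integral (f g : T -> \bar R) :
  (forall x, 0 <= f x) -> (forall x, f x <= g x) ->
  \int[mu]_x f x <= \int[mu]_x g x.
Proof.
move=> f0 fg; apply: ae_le_integral => //.
  by move=> x _; exact: le_trans (fg x).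
by apply: aeW => x _.
Qed.

(** A supremum over simple functions is in general not subadditive, but a constant can be split off:
    if a simple h lies below c + b g, then the positive part of h - c, divided by b, is measurable
    and lies below g. *)
Lemma lower_integral_affine (D : set T) (g : T -> \bar R) (c b : R) :
  measurable D -> (0 <= c)%R -> (0 < b)%R -> (forall x, 0 <= g x) ->
  \int[mu]_(x in D) (c%:E + b%:E * g x) <=
  c%:E * mu D + b%:E * \int[mu]_(x in D) g x.
Proof.
move=> mD c0 b0 g0.
have cg0 x : D x -> 0 <= c%:E + b%:E * g x.
  by move=> _; rewrite adde_ge0// mule_ge0// lee_fin ltW.
rewrite [leLHS]ge0_integralE//.
apply: ge_ereal_sup => _ [h /= hf <-].
pose F x := (Num.max (h x - c) 0 / b)%R.
have F0 x : (0 <= F x)%R by rewrite divr_ge0// ?le_max ?lexx ?orbT// ltW.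
have mF : measurable_fun setT F.
  by apply: measurable_funM => //; apply: measurable_maxr => //; exact: measurable_funB.
have FD : \int[mu]_(x in D) (F x)%:E <= \int[mu]_(x in D) g x.
  apply: ae_le_integral => //; first by move=> x _; rewrite lee_fin.
  apply: aeW => x Dx; rewrite /F maxEle; case: ifPn => // hc; first by rewrite mul0r.
  have := hf x; rewrite /patch mem_set//.
  case: (g x) (g0 x) => [r| |]// r0; last by rewrite leey.
  by rewrite -EFinM -EFinD !lee_fin ler_pdivrMr// lerBlDl mulrC.
rewrite -integralT_nnsfun.
have -> : \int[mu]_x (h x)%:E = \int[mu]_(x in D) (h x)%:E.
  rewrite [RHS]integral_mkcond; apply: eq_integral => x _.
  rewrite /patch; case: ifPn => // xD; have := hf x.
  rewrite /patch (negbTE xD) lee_fin => hx0; congr EFin; apply/eqP.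
  by rewrite eq_le hx0/=.
apply: (@le_trans _ _ (\int[mu]_(x in D) (c%:E + b%:E * (F x)%:E))).
  apply: ge0_le_integral => //.
  - by move=> x _; rewrite lee_fin.
  - by apply/measurable_EFinP; exact: measurable_funTS.
  - apply: measurable_funTS; apply: emeasurable_funD => //.
    by apply/measurable_EFinP; exact: measurable_funM.
  move=> x Dx; rewrite -EFinM -EFinD lee_fin /F mulrCA mulfV ?gt_eqF// mulr1.
  by rewrite -lerBlDl le_max lexx.
rewrite ge0_integralD//; first last.
- by apply: measurable_funTS; apply/measurable_EFinP; exact: measurable_funM.
- by move=> x _; rewrite -EFinM lee_fin mulr_ge0// ltW.
rewrite integral_cst// leeD2l// ge0_integralZl//; first last.
- by rewrite lee_fin ltW.
- by move=> x _; rewrite lee_fin.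
- by apply: measurable_funTS; exact/measurable_EFinP.
by rewrite lee_pmul2l.
Qed.

Lemma Lnorm2_sqr (f : T -> R) :
  'N[mu]_2%:E[EFin \o f] ^+ 2 = \int[mu]_x (f x ^+ 2)%:E.
Proof.
rewrite unlock poweR12_sqrt; last by rewrite integral_ge0// => x _; exact: poweR_ge0.
rewrite sqr_sqrte; last by rewrite integral_ge0// => x _; exact: poweR_ge0.
by apply: eq_integral => x _; rewrite /= powR_mulrn// real_normK// num_real.
Qed.

(** Hoelder's inequality for the splitting of k w into sqrt k and sqrt k w. For a convolution kernel
    k it reads (k * w)^2 <= ||k||_1 (k * w^2), possibly with infinite values. *)
Lemma weighted_cauchy_schwarz (k w : T -> R) :
  measurable_fun setT k -> measurable_fun setT w ->
  (forall x, 0 <= k x)%R -> (forall x, 0 <= w x)%R ->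
  (\int[mu]_x (k x * w x)%:E) ^+ 2 <=
  \int[mu]_x (k x)%:E * \int[mu]_x (k x * w x ^+ 2)%:E.
Proof.
move=> mk mw k0 w0.
pose f x := Num.sqrt (k x).
pose g x := (Num.sqrt (k x) * w x)%R.
have mf : measurable_fun setT f.
  by apply: (measurableT_comp _ mk); apply: continuous_measurable_fun; exact: sqrt_continuous.
have mg : measurable_fun setT g by exact: measurable_funM.
have := @hoelder _ _ _ mu f g 2 2 mf mg.
have -> : (2^-1 + 2^-1 = 1 :> R)%R by rewrite [RHS]splitr !div1r.
move=> /(_ (ltr0Sn _ _) (ltr0Sn _ _) erefl); rewrite Lnorm1.
have -> : \int[mu]_x `|(EFin \o (f \* g)%R) x| = \int[mu]_x (k x * w x)%:E.
  apply: eq_integral => x _ /=; congr EFin.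
  by rewrite mulrA -expr2 sqr_sqrtr// ger0_norm// mulr_ge0.
move=> H; apply: (@le_trans _ _ (('N[mu]_2%:E[EFin \o f] * 'N[mu]_2%:E[EFin \o g]) ^+ 2)).
  rewrite !expe2; apply: lee_pmul => //;
    by rewrite integral_ge0// => x _; rewrite lee_fin mulr_ge0.
rewrite expe2 muleACA -!expe2 !Lnorm2_sqr.
apply: lee_pmul; rewrite ?integral_ge0//.
- by move=> x _; rewrite lee_fin sqr_ge0.
- by move=> x _; rewrite lee_fin sqr_ge0.
- by rewrite le_eqVlt; apply/orP; left; apply/eqP; apply: eq_integral => x _; rewrite sqr_sqrtr.
- rewrite le_eqVlt; apply/orP; left; apply/eqP; apply: eq_integral => x _.
  by rewrite exprMn sqr_sqrtr.
Qed.

End LowerIntegral.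

(** * Decay and square integrability *)

Section SquareIntegrable.
Context d (T : measurableType d) {R : realType}.
Variable mu : {measure set T -> \bar R}.

Lemma Lfun_measurable (f : T -> R) p : f \in Lfun mu p -> measurable_fun setT f.
Proof. by rewrite inE => /andP[]; rewrite inE. Qed.

Lemma Lfun2P (f : T -> R) : measurable_fun setT f ->
  (\int[mu]_x (f x ^+ 2)%:E < +oo)%E -> f \in Lfun mu 2%:E.
Proof.
move=> mf f2; rewrite inE; apply/andP; split; rewrite inE//= /finite_norm.
move: f2; rewrite -Lnorm2_sqr.
by case: ('N[mu]_2%:E[EFin \o f])%E => [r| |]; rewrite ?ltry// expe2 mulyy.
Qed.

Lemma cvg_Rintegral_mul (h l : T -> R) (w : nat -> T -> R) (M : R) :
  mu.-integrable setT (EFin \o h) -> measurable_fun setT l ->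
  (forall n, measurable_fun setT (w n)) ->
  (forall n x, `|w n x| <= M) ->
  (forall x, w n x @[n --> \oo] --> l x) ->
  \int[mu]_x (h x * w n x) @[n --> \oo] --> \int[mu]_x (h x * l x).
Proof.
move=> ih ml mw wM wl.
have mh : measurable_fun setT h by have /measurable_int/measurable_EFinP := ih.
have [|||||ii _ cv] := @dominated_convergence _ _ _ mu setT measurableT
  (fun n x => (h x * w n x)%:E) (fun x => (h x * l x)%:E)
  (fun x => (M * `|h x|)%:E).
- by move=> n; apply/measurable_EFinP; exact: measurable_funM.
- by apply/measurable_EFinP; exact: measurable_funM.
- apply: aeW => x _; apply: cvg_EFin; first exact: nearW.
  exact: (cvgM (cvg_cst (h x)) (wl x)).
- have := integrableZl measurableT M (integrable_norm ih).
  by [].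
- apply: aeW => x n _ /=; rewrite lee_fin normrM mulrC ler_wpM2r//.
apply: fine_cvg; rewrite fineK//.
exact: (integrable_fin_num measurableT ii).
Qed.

End SquareIntegrable.

Section Cauchy3.
Context {R : realType}.
Notation leb := (@lebesgue_measure R).
Notation mR := (measurableTypeR R).
Notation mR3 := (mR * mR * mR)%type.
Implicit Types x y : R3 R.

Lemma continuous_proj (x : R3 R) :
  [/\ continuous (fun x : R3 R => x.1.1), continuous (fun x : R3 R => x.1.2)
   & continuous (fun x : R3 R => x.2)].
Proof.
by split; apply: (@lipschitz_continuous _ _ _ 1) => y z; rewrite mul1r;
  have := lexx `|y - z|; rewrite {1}normR3_le => /and3P[].
Qed.

Lemma onesqr_gt0 (t : R) : 0 < 1 + t ^+ 2.
Proof. by rewrite ltr_pwDl// sqr_ge0. Qed.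

Lemma cauchy3_gt0 x : 0 < cauchy3 x.
Proof. by rewrite invr_gt0 !mulr_gt0// onesqr_gt0. Qed.

Lemma cauchy3_le1 x : cauchy3 x <= 1.
Proof.
have h (t : R) : 1 <= 1 + t ^+ 2 by rewrite lerDl sqr_ge0.
by rewrite invf_le1 ?mulr_gt0 ?onesqr_gt0// !mulr_ege1.
Qed.

Lemma cauchy3N x : cauchy3 (- x) = cauchy3 x.
Proof. by rewrite /cauchy3/= !sqrrN. Qed.

Lemma continuous_cauchy3 : continuous (@cauchy3 R).
Proof.
move=> x; have [c1 c2 c3] := continuous_proj x.
have sq (f : R3 R -> R) : continuous f -> {for x, continuous (fun y => 1 + f y ^+ 2)}.
  by move=> cf; apply: cvgD; [exact: cvg_cst|apply: cvgM; exact: cf].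
apply: cvgV; first by rewrite !mulf_neq0// gt_eqF// onesqr_gt0.
by apply: cvgM; [apply: cvgM; [exact: (sq _ c1)|exact: (sq _ c2)]|exact: (sq _ c3)].
Qed.

Lemma continuous_cauchy3_affine a x0 :
  continuous (fun y => cauchy3 (a *: (y - x0))).
Proof.
move=> y; apply: (@continuous_comp _ _ _ (fun y => a *: (y - x0)) (@cauchy3 R)).
  apply: cvgZ; first exact: cvg_cst.
  by apply: cvgB; [exact: cvg_id|exact: cvg_cst].
exact: continuous_cauchy3.
Qed.

Lemma measurable_cauchy3 b x0 :
  measurable_fun [set: mR3] (fun y : R3 R => (cauchy3 (b *: (y - x0)))%:E).
Proof.
apply/measurable_EFinP.
exact: (continuous_measurableR3 (@continuous_cauchy3_affine b x0)).
Qed.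

Lemma measurable_cauchy1 (a x : R) :
  measurable_fun [set: R] (fun y : R => (1 + (a^-1 * (y - x)) ^+ 2)^-1).
Proof.
apply: continuous_measurable_fun => y; apply: cvgV; first by rewrite gt_eqF// onesqr_gt0.
apply: cvgD; first exact: cvg_cst.
by apply: cvgM; (apply: cvgM; first exact: cvg_cst);
  apply: cvgB; [exact: cvg_id|exact: cvg_cst|exact: cvg_id|exact: cvg_cst].
Qed.

Lemma integral_cauchy3 (a : R) x : 0 < a ->
  (\int[leb3]_y (cauchy3 (a^-1 *: (y - x)))%:E = ((a * pi) ^+ 3)%:E)%E.
Proof.
move=> a0.
pose p (x y : R) := (1 + (a^-1 * (y - x)) ^+ 2)^-1.
have p0 s t : 0 <= p s t by rewrite invr_ge0 ltW// onesqr_gt0.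
have E y : cauchy3 (a^-1 *: (y - x)) = p x.1.1 y.1.1 * p x.1.2 y.1.2 * p x.2 y.2.
  by rewrite /cauchy3 !invfM.
have I t : (\int[leb]_y (p t y)%:E = (a * pi)%:E)%E by exact: integral_cauchy1.
have mp t : measurable_fun [set: mR] (p t) by exact: measurable_cauchy1.
have api : 0 <= a * pi by rewrite mulr_ge0 ?pi_ge0// ltW.
have K c t : 0 <= c -> (\int[leb]_y (c%:E * (p t y)%:E) = (c * (a * pi))%:E)%E.
  move=> c0; rewrite ge0_integralZl// ?I//; first exact/measurable_EFinP.
  by move=> y _; rewrite lee_fin.
transitivity (\int[leb2]_xy \int[leb]_z (cauchy3 (a^-1 *: ((xy, z) - x)))%:E)%E.
  apply: (@fubini_tonelli1 _ _ _ _ R leb2 leb (fun y : R3 R => (cauchy3 (a^-1 *: (y - x)))%:E)).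
    exact: measurable_cauchy3.
  by move=> y; rewrite lee_fin ltW// cauchy3_gt0.
transitivity (\int[leb2]_xy ((a * pi) * (p x.1.1 xy.1 * p x.1.2 xy.2))%:E)%E.
  apply: eq_integral => -[s t] _.
  under eq_integral do rewrite E/= EFinM.
  by apply: (etrans (K _ _ _)); rewrite ?mulr_ge0//= mulrC.
transitivity (\int[leb]_s \int[leb]_t ((a * pi) * (p x.1.1 s * p x.1.2 t))%:E)%E.
  apply: (@fubini_tonelli1 _ _ _ _ R leb leb
    (fun xy : mR * mR => ((a * pi) * (p x.1.1 xy.1 * p x.1.2 xy.2))%:E)).
    apply/measurable_EFinP; apply: measurable_funM => //; apply: measurable_funM.
      exact: measurableT_comp.
    exact: measurableT_comp.
  by move=> y; rewrite lee_fin (mulr_ge0 api)// mulr_ge0.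
transitivity (\int[leb]_s ((a * pi) ^+ 2 * p x.1.1 s)%:E)%E.
  apply: eq_integral => s _.
  under eq_integral do rewrite mulrA EFinM.
  apply: (etrans (K _ _ _)); first by rewrite (mulr_ge0 api).
  by congr EFin; ring.
under eq_integral do rewrite EFinM.
apply: (etrans (K _ _ _)); first exact: exprn_ge0.
by congr EFin; ring.
Qed.

(** As [cauchy3] is at most 1, its square is dominated by itself, and integrability of the majorant
    is enough. *)
Lemma Lfun2_decay (F : R3 R -> R) (C b : R) x : continuous F -> 0 <= C -> 0 < b ->
  (forall y, `|F y| <= C * cauchy3 (b *: (y - x))) -> F \in Lfun leb3 2%:E.
Proof.
move=> cF C0 b0 FC; apply: Lfun2P; first exact: continuous_measurableR3.
apply: (@le_lt_trans _ _ (\int[leb3]_y ((C ^+ 2)%:E * (cauchy3 (b *: (y - x)))%:E))%E).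
  apply: ge0_le_lower_integral => y; first by rewrite lee_fin sqr_ge0.
  rewrite -EFinM lee_fin -[F y ^+ 2]ger0_norm ?sqr_ge0// normrX.
  apply: (@le_trans _ _ ((C * cauchy3 (b *: (y - x))) ^+ 2)).
    by rewrite ler_pXn2r// nnegrE// ?mulr_ge0// ltW// cauchy3_gt0.
  rewrite exprMn ler_wpM2l ?sqr_ge0// expr2 ler_piMr ?cauchy3_le1//.
  by rewrite ltW// cauchy3_gt0.
rewrite ge0_integralZl//; last 3 first.
- exact: measurable_cauchy3.
- by move=> y _; rewrite lee_fin ltW// cauchy3_gt0.
- by rewrite lee_fin sqr_ge0.
by rewrite -[b]invrK integral_cauchy3 ?invr_gt0// -EFinM ltry.
Qed.

End Cauchy3.

(** * Weak derivatives against decaying functions *)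

Section WeakDerivative.
Context {R : realType}.
Notation mR := (measurableTypeR R).
Notation mR3 := (mR * mR * mR)%type.
Implicit Types (f g F psi chi : R3 R -> R) (x : R3 R).

Lemma supp_bounded_support psi : compact (supp psi) -> bounded_support psi.
Proof.
move=> /compact_bounded[M [_ /(_ (M + 1))]]; rewrite ltrDl ltr01 => /(_ isT) H.
exists (M + 1) => x Mx; apply: contrapT => /eqP px.
have : supp psi x by apply: subset_closure.
by move/H => /=; rewrite leNgt Mx.
Qed.

Lemma bounded_support_test_function psi : smooth psi -> bounded_support psi ->
  test_function psi.
Proof.
move=> spsi [r psir]; split=> //.
have cb : closed [set x : R3 R | `|x| <= r].
  by apply: compact_closed; [exact: norm_hausdorff|exact: compact_box].
apply: (subclosed_compact _ (@compact_box R r)); first exact: closed_closure.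
rewrite [X in _ `<=` X]((closure_id _).1 cb); apply: closureS => x /= px.
by rewrite leNgt; apply: contra px => /psir ->.
Qed.

Lemma integrable_mul_bounded (h w : R3 R -> R) (M : R) :
  leb3.-integrable setT (EFin \o h) -> measurable_fun [set: mR3] w ->
  (forall x, `|w x| <= M) ->
  leb3.-integrable setT (EFin \o (fun x => h x * w x)).
Proof.
move=> ih mw wM.
have mh : measurable_fun [set: mR3] h by have /measurable_int/measurable_EFinP := ih.
have := integrableZl measurableT M (integrable_norm ih).
apply: le_integrable => //.
  by apply/measurable_EFinP; exact: measurable_funM.
move=> x _ /=; rewrite lee_fin normrM [leRHS]normrM mulrC normr_id ler_wpM2r//.
exact: le_trans (wM x) (ler_norm M).
Qed.

(** The definition of the weak derivative tests against compactly supported functions, while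
    Littlewood-Paley kernels only decay. F is cut off by chi(x / (n + 1)), the Littlewood-Paley
    cutoff serving in physical space; the term where the cutoff is differentiated carries a factor 1
    / (n + 1), and dominated convergence gives the limit. *)
Lemma weak_derivative_Lfun2 chi f (j : 'I_3) g F : lp_cutoff chi ->
  f \in Lfun leb3 2%:E -> is_weak_derivative f j g -> smooth F ->
  F \in Lfun leb3 2%:E -> 'D_(Defs.basis j) F \in Lfun leb3 2%:E ->
  \int[leb3]_x (f x * 'D_(Defs.basis j) F x) = - \int[leb3]_x (g x * F x).
Proof.
move=> [[schi kchi] _ _ _ chi1] f2 [g2 fg] sF F2 DF2; set e := Defs.basis j.
have bchi := supp_bounded_support kchi.
have sD := smooth_derive e schi; have bD := bounded_support_derive e bchi.
have [M M0 chiM] := bounded_support_bounded (smooth_continuous schi) bchi.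
have [M' M'0 chiM'] := bounded_support_bounded (smooth_continuous sD) bD.
pose b n : R := n.+1%:R^-1.
have b0 n : 0 < b n by rewrite invr_gt0.
have b1 n : b n <= 1 by rewrite invf_le1// ler1n.
pose w n := scaled (b n) chi.
pose dw n x := b n * scaled (b n) ('D_e chi) x.
have sw n : smooth (w n) by exact: smooth_scaled.
have DwE n : 'D_e (w n) = dw n by rewrite /w derive_scaled.
have mw n : measurable_fun [set: mR3] (w n).
  exact: continuous_measurableR3 (smooth_continuous (sw n)).
have mdw n : measurable_fun [set: mR3] (dw n).
  by rewrite -DwE; exact: continuous_measurableR3 (smooth_continuous (smooth_derive e (sw n))).
have wM n x : `|w n x| <= M by exact: chiM.
have dwb n x : `|dw n x| <= b n * M'.
  by rewrite normrM gtr0_norm// ler_wpM2l ?(ltW (b0 n))//; exact: chiM'.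
have dwM n x : `|dw n x| <= M'.
  by apply: (le_trans (dwb n x)); rewrite ler_piMl// ltW.
have bn0 : b n @[n --> \oo] --> (0 : R) by exact: cvg_harmonic.
have w1 x : w n x @[n --> \oo] --> (1 : R).
  apply: cvg_near_cst; near=> n.
  apply: chi1.
  (* A max norm of at most 1/4 gives, by [dot_le], a squared Euclidean length of at most 3/16, below
     (1/2)^2. *)
  have nx : `|b n *: x| <= 4^-1.
    rewrite prod_norm_scale gtr0_norm// mulrC; near: n.
    have : `|x| * b n @[n --> \oo] --> `|x| * 0 by exact: (cvgM (cvg_cst _) bn0).
    by rewrite mulr0 => /cvgr_le; apply; rewrite invr_gt0.
  have -> : (2^-1 : R) = Num.sqrt (2^-1 ^+ 2) by rewrite sqrtr_sqr gtr0_norm.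
  rewrite /euclid ler_wsqrtr//.
  apply: (le_trans (ler_norm _)); apply: (le_trans (dot_le _ _)).
  have : `|b n *: x| * `|b n *: x| <= 4^-1 * 4^-1 by rewrite ler_pM.
  by move=> H; lra.
have dw0 x : dw n x @[n --> \oo] --> (0 : R).
  apply/cvgr0Pnorm_le => ep ep0; near=> n.
  apply: (le_trans (dwb n x)); near: n.
  have : b n * M' @[n --> \oo] --> 0 * M' by exact: (cvgM bn0 (cvg_cst _)).
  by rewrite mul0r => /cvgr_le; apply.
have ifF : leb3.-integrable setT (EFin \o (fun x => f x * F x)).
  by have /Lfun1_integrable := Lfun2_mul_Lfun1 f2 F2.
have ifDF : leb3.-integrable setT (EFin \o (fun x => f x * 'D_e F x)).
  by have /Lfun1_integrable := Lfun2_mul_Lfun1 f2 DF2.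
have igF : leb3.-integrable setT (EFin \o (fun x => g x * F x)).
  by have /Lfun1_integrable := Lfun2_mul_Lfun1 g2 F2.
have L1 := cvg_Rintegral_mul ifF (measurable_cst (0 : R)) mdw dwM dw0.
have L2 := cvg_Rintegral_mul ifDF (measurable_cst (1 : R)) mw wM w1.
have L3 := cvg_Rintegral_mul igF (measurable_cst (1 : R)) mw wM w1.
have E n : \int[leb3]_x (f x * F x * dw n x) + \int[leb3]_x (f x * 'D_e F x * w n x) =
    - \int[leb3]_x (g x * F x * w n x).
  rewrite -RintegralD//; last 2 first.
  - exact: integrable_mul_bounded ifF (mdw n) (dwM n).
  - exact: integrable_mul_bounded ifDF (mw n) (wM n).
  have tF : test_function (fun x => F x * w n x).
    apply: bounded_support_test_function; first exact: (smoothM sF (sw n)).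
    by apply: bounded_supportMl; exact: bounded_support_scaled.
  have := fg _ tF; rewrite -/e.
  have -> : \int[leb3]_x (g x * F x * w n x) = \int[leb3]_x (g x * (F x * w n x)).
    by apply: eq_Rintegral => x _; rewrite mulrA.
  move=> <-; apply: eq_Rintegral => x _.
  have -> : 'D_e (fun x => F x * w n x) x = F x * dw n x + w n x * 'D_e F x.
    rewrite -DwE; exact: (deriveM (smooth_derivable sF) (smooth_derivable (sw n))).
  by ring.
have L12 := cvgD L1 L2.
have L3' : \int[leb3]_x (f x * F x * dw n x) + \int[leb3]_x (f x * 'D_e F x * w n x)
    @[n --> \oo] --> - \int[leb3]_x (g x * F x * cst 1 x).
  by rewrite (funext E); exact: (cvgN L3).
have : \int[leb3]_x (f x * F x * cst 0 x) + \int[leb3]_x (f x * 'D_e F x * cst 1 x) =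
    - \int[leb3]_x (g x * F x * cst 1 x).
  exact: (@norm_cvg_unique R R _ _ _ _ (L12 _) L3').
have -> : \int[leb3]_x (f x * F x * cst 0 x) = 0.
  by under eq_Rintegral => x _ do rewrite /= mulr0; rewrite /Rintegral integral0.
have cst1 (h : R3 R -> R) : \int[leb3]_x (h x * cst 1 x) = \int[leb3]_x h x.
  by apply: eq_Rintegral => x _; rewrite mulr1.
by rewrite add0r !cst1.
Unshelve. all: end_near. Qed.

Lemma lp_cutoff_smooth chi : lp_cutoff chi -> smooth chi /\ bounded_support chi.
Proof. by move=> [[schi /supp_bounded_support bchi] _ _ _ _]. Qed.

(** * Division of the annulus multiplier by the frequency *)

Section SpectralPotential.
Variable chi : R3 R -> R.
Hypothesis Hchi : lp_cutoff chi.

(** The profile of all the multipliers: the one of index q is [scaled (2 ^- q) annulus]. *)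
Definition annulus x : R := scaled 2^-1 chi x - chi x.

(* Equal to |xi|^2 where the annulus multiplier is nonzero, and smooth and
   positive everywhere. *)
Definition annulus_den x : R := dot x x + scaled 2 chi x.

(* Since sum_j xi_j * annulus_potential j xi = annulus xi, the kernel of a
   Littlewood-Paley piece is a divergence. *)
Definition annulus_potential (j : 'I_3) x : R :=
  annulus x * (annulus_den x)^-1 * dot (Defs.basis j) x.

Lemma dot_basis_sqr x : \sum_(j < 3) dot (Defs.basis j) x ^+ 2 = dot x x.
Proof.
rewrite !big_ord_recl big_ord0 /dot/Defs.basis/=.
rewrite !mul0r !mul1r; ring.
Qed.

Lemma dot_ge0 x : 0 <= dot x x.
Proof. by rewrite -dot_basis_sqr sumr_ge0// => j _; exact: sqr_ge0. Qed.

Lemma euclidZ (a : R) x : 0 <= a -> euclid (a *: x) = a * euclid x.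
Proof.
move=> a0; rewrite /euclid dotZl dotC dotZl mulrA -expr2 sqrtrM ?sqr_ge0//.
by rewrite sqrtr_sqr ger0_norm.
Qed.

(** The two nonnegative terms never vanish together: |x|^2 is zero only at the origin, where chi(2
    x) = 1. *)
Lemma annulus_den_gt0 x : 0 < annulus_den x.
Proof.
have [_ _ chi0 _ chi1] := Hchi.
have [x0|x0] := ltP 0 (dot x x); first by rewrite ltr_pwDl// chi0.
have x00 : dot x x = 0 by apply/eqP; rewrite eq_le x0 dot_ge0.
rewrite /annulus_den x00 add0r /scaled chi1 ?ltr01//.
by rewrite euclidZ// /euclid x00 sqrtr0 mulr0 invr_ge0.
Qed.

Lemma smooth_annulus : smooth annulus /\ bounded_support annulus.
Proof.
have [sc bc] := lp_cutoff_smooth Hchi; split.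
  exact: (smoothB (smooth_scaled _ sc) sc).
apply: bounded_supportD; first by apply: bounded_support_scaled; rewrite ?invr_gt0.
exact: bounded_supportN.
Qed.

Lemma smooth_annulus_potential j :
  smooth (annulus_potential j) /\ bounded_support (annulus_potential j).
Proof.
have [sc bc] := lp_cutoff_smooth Hchi; have [sa ba] := smooth_annulus; split.
  apply: smoothM; last exact: smooth_dot.
  apply: (smoothM sa); apply: smoothV.
    by move=> x; rewrite gt_eqF// annulus_den_gt0.
  apply: smoothD; last exact: smooth_scaled.
  have -> : (fun x => dot x x) = fun x => dot (Defs.basis (inord 0)) x * dot (Defs.basis (inord 0)) x +
     dot (Defs.basis (inord 1)) x * dot (Defs.basis (inord 1)) x +
     dot (Defs.basis (inord 2)) x * dot (Defs.basis (inord 2)) x.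
    apply/funext => x; rewrite /dot/Defs.basis !inordK//=.
    by rewrite !mul0r !mul1r; ring.
  by do 2?[apply: smoothD]; apply: smoothM; exact: smooth_dot.
by do 2!apply: bounded_supportM.
Qed.

(** For |x| <= 1/2 both values of chi in [annulus] are 1 and both sides vanish. For |x| > 1/2 the
    point 2 x is outside the support of chi, so the denominator is exactly |x|^2. *)
Lemma annulus_potentialE x :
  \sum_(j < 3) dot (Defs.basis j) x * annulus_potential j x = annulus x.
Proof.
have -> : \sum_(j < 3) dot (Defs.basis j) x * annulus_potential j x =
    annulus x * (annulus_den x)^-1 * dot x x.
  rewrite -dot_basis_sqr mulr_sumr; apply: eq_bigr => j _.
  by rewrite /annulus_potential expr2; ring.
have [_ suppchi _ _ chi1] := Hchi.
have [x2|x2] := leP (euclid x) 2^-1.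
  rewrite /annulus /scaled !chi1 ?subrr ?mul0r//.
  rewrite euclidZ ?invr_ge0//; apply: le_trans x2.
  by rewrite ler_piMl ?sqrtr_ge0// invf_le1// ler1n.
have -> : annulus_den x = dot x x.
  rewrite /annulus_den; suff -> : scaled 2 chi x = 0 by rewrite addr0.
  apply: contrapT => /eqP c0; have : supp chi (2 *: x) by exact: subset_closure.
  move/suppchi => /=; rewrite euclidZ// ltNge => /negP; apply.
  by rewrite -ler_pdivrMl// mulr1 ltW.
rewrite mulfVK//; apply: contraTneq x2 => x0.
by rewrite /euclid x0 sqrtr0 -leNgt invr_ge0.
Qed.

End SpectralPotential.

End WeakDerivative.

(** * Littlewood-Paley kernels *)

Section Kernel.
Context {R : realType}.
Notation mR := (measurableTypeR R).
Notation mR3 := (mR * mR * mR)%type.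
Implicit Types (x y : R3 R).
Variable chi : R3 R -> R.
Hypothesis Hchi : lp_cutoff chi.

Definition fourier_cst : R := (2 * pi) ^- 3.

Lemma sum3 (V : nmodType) (h : 'I_3 -> V) : \sum_(j < 3) h j =
  h ord0 + (h (lift ord0 ord0) + h (lift ord0 (lift ord0 ord0))).
Proof. by rewrite !big_ord_recl big_ord0 addr0. Qed.

Lemma Rintegral_oppr_sum3 (h : 'I_3 -> R3 R -> R) :
  (forall j, leb3.-integrable setT (EFin \o h j)) ->
  \int[leb3]_x (- \sum_(j < 3) h j x) = - \sum_(j < 3) \int[leb3]_x h j x.
Proof.
move=> hi.
have hi2 := integrableD measurableT (hi (lift ord0 ord0)) (hi (lift ord0 (lift ord0 ord0))).
have hi3 := integrableD measurableT (hi ord0) hi2.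
rewrite [in RHS]sum3 -RintegralD// -RintegralD// -mulN1r -RintegralZl//.
by apply: eq_Rintegral => x _; rewrite sum3 mulN1r.
Qed.

Lemma lp_kernelE q x : lp_kernel chi q x =
  fourier_cst * osc (scaled (2 ^- q) (annulus chi)) 0 x.
Proof.
rewrite /lp_kernel/=; congr (_ * _); apply: eq_Rintegral => xi _.
by rewrite addr0.
Qed.

Lemma oscD (psi1 psi2 : R3 R -> R) th x :
  continuous psi1 -> bounded_support psi1 ->
  continuous psi2 -> bounded_support psi2 ->
  osc (fun xi => psi1 xi + psi2 xi) th x = osc psi1 th x + osc psi2 th x.
Proof.
move=> c1 b1 c2 b2; rewrite /osc -RintegralD//; try exact: osc_integrable.
by apply: eq_Rintegral => xi _; rewrite mulrDl.
Qed.

(** Symbol of the single summand D_j M_j at q = 0. Being smooth with bounded support by itself, it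
    gives decay for each summand and not only for their sum. *)
Definition divergence_symbol (j : 'I_3) : R3 R -> R :=
  fun xi => dot (Defs.basis j) xi * annulus_potential chi j xi.

Lemma smooth_divergence_symbol j :
  smooth (divergence_symbol j) /\ bounded_support (divergence_symbol j).
Proof.
have [s b] := smooth_annulus_potential Hchi j; split.
  exact: (smoothM (smooth_dot _) s).
exact: bounded_supportMl.
Qed.

(** The phase - pi / 2 is the division by i that the derivative undoes, returning to phase 0. The
    factor 2^-q turns the xi_j produced by that derivative into the j-th coordinate of 2^-q xi. *)
Definition potential_kernel q (j : 'I_3) x : R :=
  fourier_cst * 2 ^- q * osc (scaled (2 ^- q) (annulus_potential chi j)) (- (pi / 2)) x.

Lemma pow2V_gt0 q : 0 < 2 ^- q :> R.
Proof. by rewrite invr_gt0 exprn_gt0. Qed.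
Hint Resolve pow2V_gt0 : core.

Lemma smooth_potential_kernel q j : smooth (potential_kernel q j).
Proof.
have [s b] := smooth_annulus_potential Hchi j.
apply: (smoothM (smooth_cst _)); apply: smooth_osc.
  exact: smooth_continuous (smooth_scaled _ s).
exact: bounded_support_scaled.
Qed.

Lemma derive_potential_kernel q j x :
  'D_(Defs.basis j) (potential_kernel q j) x =
  fourier_cst * osc (scaled (2 ^- q) (divergence_symbol j)) 0 x.
Proof.
have [s b] := smooth_annulus_potential Hchi j.
have cs := smooth_continuous (smooth_scaled (2 ^- q) s).
have bs := bounded_support_scaled (pow2V_gt0 q) b.
have [d1 d2] := is_derive_osc (- (pi / 2)) x (Defs.basis j) cs bs.
rewrite /potential_kernel deriveMl// d2 addNr /GRing.scale/= -mulrA; congr (_ * _).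
rewrite -oscZ; [|exact: continuous_dotM|exact: bounded_supportMl].
apply: eq_Rintegral => xi _; congr (_ * _).
by rewrite /scaled /divergence_symbol !(dotC (Defs.basis j)) dotZl mulrA.
Qed.

Lemma lp_kernel_divergence q x : lp_kernel chi q x =
  \sum_(j < 3) 'D_(Defs.basis j) (potential_kernel q j) x.
Proof.
rewrite lp_kernelE; under eq_bigr do rewrite derive_potential_kernel.
rewrite -mulr_sumr; congr (_ * _).
have c j := smooth_continuous (smooth_scaled (2 ^- q) (smooth_divergence_symbol j).1).
have b j := bounded_support_scaled (pow2V_gt0 q) (smooth_divergence_symbol j).2.
rewrite !big_ord_recl big_ord0 addr0.
rewrite -oscD; [|exact: c|exact: b|exact: c|exact: b].
rewrite -oscD; [|exact: c|exact: b| |exact: bounded_supportD]; last first.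
  by move=> xi; apply: cvgD; exact: c.
apply: eq_Rintegral => xi _; congr (_ * _).
rewrite /scaled -(annulus_potentialE Hchi) !big_ord_recl big_ord0 addr0.
by rewrite /divergence_symbol.
Qed.

(** The frequency support has volume of order 2^(3q); the prefactor 2^-q of the potential lowers the
    power to 2^(2q), and the derivative restores it. *)
Lemma potential_kernel_decay : exists2 B, 0 < B & forall q j x,
  `|potential_kernel q j x| <= B * 2 ^+ q ^+ 2 * cauchy3 (2 ^+ q *: x) /\
  `|'D_(Defs.basis j) (potential_kernel q j) x| <=
    B * 2 ^+ q ^+ 3 * cauchy3 (2 ^+ q *: x).
Proof.
have c0 : 0 < fourier_cst by rewrite invr_gt0 exprn_gt0// mulr_gt0 ?pi_gt0.
have /choice[C1 HC1] : forall j : 'I_3, exists C, 0 < C /\ forall a th x, 0 < a ->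
    `|osc (scaled a (annulus_potential chi j)) th x| <= C / a ^+ 3 * cauchy3 (a^-1 *: x).
  move=> j; have [s b] := smooth_annulus_potential Hchi j.
  by have [C ? ?] := osc_scaled_decay s b; exists C.
have /choice[C2 HC2] : forall j : 'I_3, exists C, 0 < C /\ forall a th x, 0 < a ->
    `|osc (scaled a (divergence_symbol j)) th x| <= C / a ^+ 3 * cauchy3 (a^-1 *: x).
  move=> j; have [s b] := smooth_divergence_symbol j.
  by have [C ? ?] := osc_scaled_decay s b; exists C.
pose S := \sum_j (C1 j + C2 j).
have CS j : C1 j <= S /\ C2 j <= S.
  have le1 : C1 j + C2 j <= S.
    rewrite /S (bigD1 j)//= lerDl sumr_ge0// => i _.
    by rewrite addr_ge0// ltW//; [case: (HC1 i)|case: (HC2 i)].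
  split; apply: le_trans le1.
    by rewrite lerDl ltW//; case: (HC2 j).
  by rewrite lerDr ltW//; case: (HC1 j).
have S0 : 0 < S by apply: lt_le_trans (CS ord0).1; case: (HC1 ord0).
exists (fourier_cst * S); first exact: mulr_gt0.
move=> q j x; have [C1S C2S] := CS j.
have ca := cauchy3_gt0 (2 ^+ q *: x); split.
  rewrite /potential_kernel normrM (gtr0_norm (mulr_gt0 c0 (pow2V_gt0 q))).
  have [_ /(_ (2 ^- q) (- (pi / 2)) x (pow2V_gt0 q))] := HC1 j.
  rewrite invrK => H.
  apply: (@le_trans _ _ (fourier_cst * 2 ^- q * (S / (2 ^- q) ^+ 3 * cauchy3 (2 ^+ q *: x)))).
    rewrite ler_wpM2l ?mulr_ge0 ?(ltW c0) ?(ltW (pow2V_gt0 q))//.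
    apply: (le_trans H); rewrite ler_wpM2r ?(ltW ca)// ler_wpM2r//.
  rewrite le_eqVlt; apply/orP; left; apply/eqP.
  by field; rewrite expf_neq0.
rewrite derive_potential_kernel normrM (gtr0_norm c0).
have [_ /(_ (2 ^- q) 0 x (pow2V_gt0 q))] := HC2 j.
rewrite invrK => H.
apply: (@le_trans _ _ (fourier_cst * (S / (2 ^- q) ^+ 3 * cauchy3 (2 ^+ q *: x)))).
  rewrite ler_wpM2l ?(ltW c0)//.
  apply: (le_trans H); rewrite ler_wpM2r ?(ltW ca)// ler_wpM2r//.
rewrite le_eqVlt; apply/orP; left; apply/eqP.
by field; rewrite expf_neq0.
Qed.

Lemma reflected_potential_kernel q j x :
  let F y := potential_kernel q j (x - y) in
  [/\ smooth F, F \in Lfun leb3 2%:E, 'D_(Defs.basis j) F \in Lfun leb3 2%:E &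
      forall y, 'D_(Defs.basis j) F y = - 'D_(Defs.basis j) (potential_kernel q j) (x - y)].
Proof.
move=> F; have FE : F = fun y => potential_kernel q j (x + (-1) *: y).
  by apply/funext => y; rewrite /F scaleN1r.
have sF : smooth F by rewrite FE; apply: smooth_affine; exact: smooth_potential_kernel.
have DF y : 'D_(Defs.basis j) F y = - 'D_(Defs.basis j) (potential_kernel q j) (x - y).
  rewrite FE derive_affine scaleN1r.
  have [_ ->] := @derive_scale _ _ (potential_kernel q j) (-1) (Defs.basis j) (x - y)
    (smooth_derivable (smooth_potential_kernel q j)).
  by rewrite mulN1r.
have [B B0 HB] := potential_kernel_decay.
have p0 n : 0 <= B * 2 ^+ q ^+ n by rewrite mulr_ge0 ?exprn_ge0// ltW.
split => //.
- apply: (@Lfun2_decay _ F (B * 2 ^+ q ^+ 2) (2 ^+ q) x) => //.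
  + exact: smooth_continuous.
  + by move=> y; rewrite -cauchy3N -scalerN opprB; case: (HB q j (x - y)).
- apply: (@Lfun2_decay _ _ (B * 2 ^+ q ^+ 3) (2 ^+ q) x) => //.
  + exact: smooth_continuous (smooth_derive _ sF).
  + by move=> y; rewrite DF normrN -cauchy3N -scalerN opprB; case: (HB q j (x - y)).
Qed.

(** The minus sign from differentiating y -> M_j(x - y) cancels the one in the definition of the
    weak derivative. *)
Lemma lp_convolution_gradient q (f : R3 R -> R) (g : 'I_3 -> R3 R -> R) x :
  f \in Lfun leb3 2%:E -> (forall j, is_weak_derivative f j (g j)) ->
  \int[leb3]_y (lp_kernel chi q (x - y) * f y) =
  \sum_(j < 3) \int[leb3]_y (potential_kernel q j (x - y) * g j y).
Proof.
move=> f2 fg.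
have W j := reflected_potential_kernel q j x.
have I j : leb3.-integrable setT (EFin \o (fun y => f y *
    'D_(Defs.basis j) (fun y => potential_kernel q j (x - y)) y)).
  by have [_ _ DF2 _] := W j; have /Lfun1_integrable := Lfun2_mul_Lfun1 f2 DF2.
have D j y : 'D_(Defs.basis j) (fun y => potential_kernel q j (x - y)) y =
    - 'D_(Defs.basis j) (potential_kernel q j) (x - y) by have [_ _ _] := W j.
transitivity (- \sum_(j < 3) \int[leb3]_y (f y *
    'D_(Defs.basis j) (fun y => potential_kernel q j (x - y)) y)).
  rewrite -(Rintegral_oppr_sum3 I); apply: eq_Rintegral => y _.
  rewrite lp_kernel_divergence mulr_suml -sumrN; apply: eq_bigr => j _.
  by rewrite D mulrN opprK mulrC.
rewrite -sumrN; apply: eq_bigr => j _.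
have [sF F2 DF2 _] := W j.
rewrite (weak_derivative_Lfun2 Hchi f2 (fg j) sF F2 DF2) opprK.
by apply: eq_Rintegral => y _; rewrite mulrC.
Qed.

End Kernel.

(** * Littlewood-Paley estimates *)

Section Estimates.
Context {R : realType}.
Notation mR := (measurableTypeR R).
Notation mR3 := (mR * mR * mR)%type.
Implicit Types (x y : R3 R).

Lemma sqr_Rintegral_le d (T : measurableType d) (mu : {measure set T -> \bar R})
    (h : T -> R) : measurable_fun setT h ->
  (((\int[mu]_x h x) ^+ 2)%:E <= (\int[mu]_x `|h x|%:E) ^+ 2)%E.
Proof.
move=> mh.
have H : (`|\int[mu]_x h x|%:E <= \int[mu]_x `|h x|%:E)%E.
  apply: (@le_trans _ _ `|\int[mu]_x (h x)%:E|%E).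
    (* An infinite integral has real value 0, so the inequality persists without integrability. *)
    by rewrite /Rintegral; case: (\int[mu]_x _)%E => //=; rewrite normr0 leey.
  by apply: (le_abse_integral mu measurableT); exact/measurable_EFinP.
rewrite -real_normK ?num_real// expr2 EFinM expe2.
by apply: lee_pmul; rewrite ?lee_fin.
Qed.

Lemma measurable_subR3 : measurable_fun [set: mR3 * mR3]
  (fun p : mR3 * mR3 => ((p.2 : R3 R) - p.1 : mR3)).
Proof.
have m11 : measurable_fun [set: mR3] (fun x : mR3 => x.1.1).
  by apply: measurableT_comp.
have m12 : measurable_fun [set: mR3] (fun x : mR3 => x.1.2).
  by apply: measurableT_comp.
have m2 : measurable_fun [set: mR3] (fun x : mR3 => x.2) by exact: measurable_snd.
have sub (f : mR3 -> mR) : measurable_fun [set: mR3] f ->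
    measurable_fun [set: mR3 * mR3] (fun p : mR3 * mR3 => (f p.2 : R) - f p.1).
  move=> mf; apply: measurable_funB; first exact: (measurableT_comp mf measurable_snd).
  exact: (measurableT_comp mf measurable_fst).
apply: (measurable_fun_pair (f := fun p : mR3 * mR3 => ((p.2 : R3 R) - p.1).1 : mR * mR)
   (g := fun p : mR3 * mR3 => ((p.2 : R3 R) - p.1).2 : mR)); last exact: (sub _ m2).
apply: (measurable_fun_pair (f := fun p : mR3 * mR3 => ((p.2 : R3 R) - p.1).1.1 : mR)
   (g := fun p : mR3 * mR3 => ((p.2 : R3 R) - p.1).1.2 : mR)).
  exact: (sub _ m11).
exact: (sub _ m12).
Qed.

Lemma measurable_cauchy3_sub (b : R) : measurable_fun [set: mR3 * mR3]
  (fun p : mR3 * mR3 => cauchy3 (b *: ((p.2 : R3 R) - p.1))).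
Proof.
have mc : measurable_fun [set: mR3] (fun x : R3 R => cauchy3 (b *: x)).
  apply: continuous_measurableR3 => x.
  apply: (@continuous_comp _ _ _ (fun y : R3 R => b *: y) (@cauchy3 R)).
    by apply: cvgZ; [exact: cvg_cst|exact: cvg_id].
  exact: continuous_cauchy3.
exact: (measurableT_comp mc measurable_subR3).
Qed.

Lemma integral_cauchy3_scale (b : R) x : 0 < b ->
  (\int[leb3]_y (cauchy3 (b *: (y - x)))%:E = ((b^-1 * pi) ^+ 3)%:E)%E.
Proof.
by move=> b0; have := integral_cauchy3 x (_ : 0 < b^-1); rewrite invrK; apply; rewrite invr_gt0.
Qed.

(** Young's inequality in L^1, an equality for nonnegative functions: integrating in x first, the
    even kernel contributes its full mass (pi / b)^3 for every y. *)
Lemma weighted_cauchy3_tonelli (b : R) (w : R3 R -> R) :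
  0 < b -> measurable_fun [set: mR3] w -> (forall y, 0 <= w y) ->
  let H x := (\int[leb3]_y (cauchy3 (b *: (y - x)) * w y)%:E)%E in
  measurable_fun [set: mR3] H /\
  (\int[leb3]_x H x = ((b^-1 * pi) ^+ 3)%:E * \int[leb3]_y (w y)%:E)%E.
Proof.
move=> b0 mw w0 H.
pose f (p : mR3 * mR3) := (cauchy3 (b *: ((p.2 : R3 R) - p.1)) * w p.2)%:E.
have mf : measurable_fun [set: mR3 * mR3] f.
  apply/measurable_EFinP; apply: measurable_funM.
    exact: measurable_cauchy3_sub.
  exact: (measurableT_comp mw measurable_snd).
have f0 p : (0 <= f p)%E by rewrite lee_fin mulr_ge0// ltW// cauchy3_gt0.
split; first exact: (@measurable_fun_fubini_tonelli_F _ _ _ _ _ leb3s f mf f0).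
transitivity (\int[leb3]_y \int[leb3]_x f (x, y))%E.
  exact: (@fubini_tonelli _ _ _ _ R leb3s leb3s f mf f0).
transitivity (\int[leb3]_y (((b^-1 * pi) ^+ 3)%:E * (w y)%:E))%E; last first.
  rewrite ge0_integralZl//; first exact/measurable_EFinP.
  - by move=> y _; rewrite lee_fin.
  - by rewrite lee_fin exprn_ge0// mulr_ge0 ?pi_ge0// invr_ge0 ltW.
apply: eq_integral => y _; rewrite /f/=.
transitivity (\int[leb3]_x ((w y)%:E * (cauchy3 (b *: (x - y)))%:E))%E.
  apply: eq_integral => x _; rewrite -EFinM mulrC; congr (_ * _)%:E.
  by rewrite -cauchy3N -scalerN opprB.
rewrite ge0_integralZl//; last by rewrite lee_fin.
- by rewrite integral_cauchy3_scale// muleC.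
- exact: measurable_cauchy3.
- by move=> x _; rewrite lee_fin ltW// cauchy3_gt0.
Qed.

Lemma sqr_sum3_le (t : 'I_3 -> R) :
  (\sum_(j < 3) t j) ^+ 2 <= 3 * \sum_(j < 3) t j ^+ 2.
Proof.
rewrite !sum3; set x := t _; set y := t _; set z := t _.
have : 0 <= (x - y) ^+ 2 + (x - z) ^+ 2 + (y - z) ^+ 2 by rewrite !addr_ge0// sqr_ge0.
move=> K; rewrite -subr_ge0.
suff -> : 3 * (x ^+ 2 + (y ^+ 2 + z ^+ 2)) - (x + (y + z)) ^+ 2 =
  (x - y) ^+ 2 + (x - z) ^+ 2 + (y - z) ^+ 2 by [].
ring.
Qed.

Variable chi : R3 R -> R.
Hypothesis Hchi : lp_cutoff chi.

(** H is the majorant cauchy3-kernel * |grad f|^2, suitably scaled. It is stated as a measurable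
    function so that the integrals for the three components of a vector field can be added, and it
    carries both the pointwise and the integrated bound. *)
Lemma lp_scalar_estimates : exists2 C : R, 0 < C &
  forall q (f : R3 R -> R) (g : 'I_3 -> R3 R -> R),
  f \in Lfun leb3 2%:E -> (forall j, is_weak_derivative f j (g j)) ->
  exists H : R3 R -> \bar R,
  [/\ measurable_fun [set: mR3] H, forall x, (0 <= H x)%E,
      forall x, (((\int[leb3]_y (lp_kernel chi q (x - y) * f y)) ^+ 2)%:E <= H x)%E,
      forall x, (H x <= (C * 2 ^+ q)%:E * \sum_(j < 3) \int[leb3]_y (g j y ^+ 2)%:E)%E &
      (\int[leb3]_x H x <= (C * 2 ^- q ^+ 2)%:E * \sum_(j < 3) \int[leb3]_y (g j y ^+ 2)%:E)%E].
Proof.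
have [B B0 HB] := potential_kernel_decay Hchi.
have pi3 : 0 < pi ^+ 3 :> R by rewrite exprn_gt0// pi_gt0.
have A0 : 0 <= 3 * B ^+ 2 * pi ^+ 3.
  by apply: mulr_ge0; [apply: mulr_ge0 => //; exact: sqr_ge0|exact: ltW].
(* 3 comes from squaring a sum of three terms and B^2 pi^3 from Cauchy-Schwarz; the last factor
   covers the pointwise bound through 1 and the integrated bound through pi^3. *)
exists (3 * B ^+ 2 * pi ^+ 3 * (1 + pi ^+ 3)).
  by rewrite mulr_gt0 ?addr_gt0// mulr_gt0// mulr_gt0// exprn_gt0.
move=> q f g f2 fg; set L : R := 2 ^+ q.
have L0 : 0 < L by rewrite exprn_gt0.
have mg j : measurable_fun [set: mR3] (g j) by have [/Lfun_measurable] := fg j.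
pose w j y := g j y ^+ 2.
have w0 j y : 0 <= w j y by exact: sqr_ge0.
have mw j : measurable_fun [set: mR3] (w j) by exact: measurable_funX.
pose P j x := (\int[leb3]_y (cauchy3 (L *: (y - x)) * w j y)%:E)%E.
have PP j := weighted_cauchy3_tonelli L0 (mw j) (w0 j).
have P0 j x : (0 <= P j x)%E.
  by apply: integral_ge0 => y _; rewrite lee_fin mulr_ge0// ltW// cauchy3_gt0.
(* The two kernel factors contribute L^2 each and the mass of the weight L^-3, leaving L. *)
pose D := 3 * B ^+ 2 * pi ^+ 3 * L.
have D0 : 0 <= D by rewrite !mulr_ge0 ?exprn_ge0 ?pi_ge0 ?(ltW B0)// ltW.
pose H x := (D%:E * \sum_(j < 3) P j x)%E.
have G0 : (0 <= \sum_(j < 3) \int[leb3]_y (g j y ^+ 2)%:E)%E.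
  by apply: sume_ge0 => j _; apply: integral_ge0 => y _; rewrite lee_fin sqr_ge0.
have mP j : measurable_fun [set: mR3] (P j) by have [] := PP j.
have P3 x : (\sum_(j < 3) P j x = P ord0 x + (P (lift ord0 ord0) x + P (lift ord0 (lift ord0 ord0)) x))%E.
  exact: sum3.
have mSP : measurable_fun [set: mR3] (fun x => \sum_(j < 3) P j x)%E.
  by under eq_fun do rewrite P3; do 2?[apply: emeasurable_funD => //].
have SP0 x : (0 <= \sum_(j < 3) P j x)%E by rewrite sume_ge0.
exists H; split.
- by apply: emeasurable_funM => //; exact: measurable_cst.
- by move=> x; rewrite mule_ge0.
- move=> x.
  have kb j y : `|potential_kernel chi q j (x - y)| <= B * L ^+ 2 * cauchy3 (L *: (y - x)).
    by rewrite -cauchy3N -scalerN opprB; case: (HB q j (x - y)).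
  rewrite (lp_convolution_gradient Hchi q x f2 fg).
  pose I j := \int[leb3]_y (potential_kernel chi q j (x - y) * g j y).
  have I2 j : ((I j ^+ 2)%:E <= (B ^+ 2 * pi ^+ 3 * L)%:E * P j x)%E.
    have [sF _ _ _] := reflected_potential_kernel Hchi q j x.
    pose k y := B * L ^+ 2 * cauchy3 (L *: (y - x)).
    have BL0 : 0 <= B * L ^+ 2 by rewrite mulr_ge0 ?sqr_ge0// ltW.
    have k0 y : 0 <= k y by rewrite mulr_ge0// ltW// cauchy3_gt0.
    have mc : measurable_fun [set: mR3] (fun y : R3 R => cauchy3 (L *: (y - x))).
      by have /measurable_EFinP := @measurable_cauchy3 R L x.
    have mk : measurable_fun [set: mR3] k by exact: measurable_funM.
    have mng : measurable_fun [set: mR3] (fun y => `|g j y|) by exact: measurableT_comp.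
    apply: le_trans.
      apply: sqr_Rintegral_le; apply: measurable_funM => //.
      exact: continuous_measurableR3 (smooth_continuous sF).
    have le1 : (\int[leb3]_y `|potential_kernel chi q j (x - y) * g j y|%:E <=
        \int[leb3]_y (k y * `|g j y|)%:E)%E.
      apply: ge0_le_lower_integral => y; rewrite lee_fin//.
      by rewrite normrM ler_wpM2r// kb.
    have i0 : (0 <= \int[leb3]_y `|potential_kernel chi q j (x - y) * g j y|%:E)%E.
      by apply: integral_ge0 => y _; rewrite lee_fin.
    apply: (@le_trans _ _ ((\int[leb3]_y (k y * `|g j y|)%:E) ^+ 2)%E).
      by rewrite !expe2; apply: lee_pmul.
    apply: (le_trans (weighted_cauchy_schwarz leb3 mk mng k0 (fun y => normr_ge0 _))).
    have -> : (\int[leb3]_y (k y)%:E = (B * L ^+ 2 * (L^-1 * pi) ^+ 3)%:E)%E.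
      rewrite /k; under eq_integral do rewrite EFinM.
      rewrite ge0_integralZl//; try exact: measurable_cauchy3; try by move=> y _;
        rewrite lee_fin ltW// cauchy3_gt0.
      by rewrite integral_cauchy3_scale.
    have -> : (\int[leb3]_y (k y * `|g j y| ^+ 2)%:E = (B * L ^+ 2)%:E * P j x)%E.
      rewrite /P -ge0_integralZl//; first last.
      - by move=> y _; rewrite lee_fin mulr_ge0// ltW// cauchy3_gt0.
      - by apply/measurable_EFinP; exact: measurable_funM.
      apply: eq_integral => y _; rewrite -EFinM /k /w; congr EFin.
      by rewrite real_normK ?num_real//; ring.
    rewrite muleA -EFinM le_eqVlt; apply/orP; left; apply/eqP; congr (_%:E * _)%E.
    by field; rewrite gt_eqF.
  apply: (@le_trans _ _ (3 * \sum_(j < 3) I j ^+ 2)%:E).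
    by rewrite lee_fin; exact: sqr_sum3_le.
  rewrite /H EFinM -sumEFin.
  have -> : D%:E = (3%:E * (B ^+ 2 * pi ^+ 3 * L)%:E)%E.
    by rewrite -EFinM; congr EFin; rewrite /D; ring.
  rewrite -muleA lee_wpmul2l ?lee_fin// ge0_sume_distrr//.
  by apply: lee_sum => j _; exact: I2.
- move=> x.
  apply: (@le_trans _ _ (D%:E * \sum_(j < 3) \int[leb3]_y (g j y ^+ 2)%:E)%E).
    rewrite lee_wpmul2l ?lee_fin//; apply: lee_sum => j _.
    apply: ge0_le_lower_integral => y; rewrite lee_fin.
      by rewrite mulr_ge0// ltW// cauchy3_gt0.
    by rewrite ler_piMl ?cauchy3_le1.
  rewrite lee_wpmul2r//.
  rewrite lee_fin /D ler_wpM2r ?(ltW L0)// ler_peMr ?lerDl ?(ltW pi3)//.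
have -> : (\int[leb3]_x H x = D%:E * (((L^-1 * pi) ^+ 3)%:E * \sum_(j < 3) \int[leb3]_y (w j y)%:E))%E.
  rewrite /H ge0_integralZl//; congr (_ * _)%E.
  have IP j : (\int[leb3]_x P j x = ((L^-1 * pi) ^+ 3)%:E * \int[leb3]_y (w j y)%:E)%E.
    by case: (PP j).
  have -> : (\int[leb3]_x \sum_(j < 3) P j x = \sum_(j < 3) \int[leb3]_x P j x)%E.
    exact: ge0_integral_sum.
  rewrite (eq_bigr _ (fun j _ => IP j)) -ge0_sume_distrr//.
  by move=> j _; apply: integral_ge0 => y _; rewrite lee_fin.
rewrite muleA -EFinM lee_wpmul2r//.
rewrite lee_fin -/L.
have -> : D * (L^-1 * pi) ^+ 3 = 3 * B ^+ 2 * pi ^+ 3 * pi ^+ 3 * L^-1 ^+ 2.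
  by rewrite /D; field; rewrite gt_eqF.
by rewrite ler_wpM2r ?sqr_ge0// ler_wpM2l ?lerDr.
Qed.

End Estimates.

(** * The dissipation wavenumber *)

Section VectorEstimates.
Context {R : realType}.
Notation mR := (measurableTypeR R).
Notation mR3 := (mR * mR * mR)%type.
Implicit Types (v : vfield R).

Lemma magnitude_ge0 (I : finType) (f : tfield R I) x : 0 <= magnitude f x.
Proof. exact: sqrtr_ge0. Qed.

Lemma magnitude_sqr (I : finType) (f : tfield R I) x :
  magnitude f x ^+ 2 = \sum_i f i x ^+ 2.
Proof. by rewrite sqr_sqrtr// sumr_ge0// => i _; exact: sqr_ge0. Qed.

Lemma Lp_norm2_sqr (I : finType) (f : tfield R I) :
  (Lp_norm 2%:E f ^+ 2 = \int[leb3]_x (\sum_i f i x ^+ 2)%:E)%E.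
Proof.
by rewrite Lnorm2_sqr; apply: eq_integral => x _; rewrite magnitude_sqr.
Qed.

Lemma Lp_norm_sqr_ge0 (I : finType) p (f : tfield R I) :
  (0 <= Lp_norm p f ^+ 2)%E.
Proof. by rewrite expe2; apply: mule_ge0; exact: Lnorm_ge0. Qed.

Lemma Lp_normoo_sqr_le (I : finType) (f : tfield R I) (M : \bar R) :
  (0 <= M)%E -> (forall x, ((magnitude f x ^+ 2)%:E <= M)%E) ->
  (Lp_norm +oo f ^+ 2 <= M)%E.
Proof.
case: M => [r| |]// r0 fr; last by rewrite leey.
rewrite lee_fin in r0.
have fs x : magnitude f x <= Num.sqrt r.
  by rewrite ler_wsqrtr// -lee_fin; have := fr x; rewrite magnitude_sqr.
have X0 : (0 <= Lp_norm +oo f)%E by exact: Lnorm_ge0.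
have Xr : (Lp_norm +oo f <= (Num.sqrt r)%:E)%E.
  rewrite /Lp_norm unlock; case: ifPn => _; last by rewrite lee_fin sqrtr_ge0.
  apply/ess_supP; apply: aeW => x /=.
  by rewrite lee_fin ger0_norm ?magnitude_ge0.
apply: (@le_trans _ _ ((Num.sqrt r)%:E * (Num.sqrt r)%:E)%E).
  by rewrite expe2; exact: lee_pmul.
by rewrite -EFinM -expr2 sqr_sqrtr.
Qed.

Lemma sum3_cst (M : \bar R) : (0 <= M)%E -> (\sum_(i < 3) M = 3%:E * M)%E.
Proof.
move=> M0; have -> : 3%:E = (1%:E + (1%:E + 1%:E))%E :> \bar R.
  by rewrite -!EFinD; congr EFin; ring.
by rewrite !ge0_muleDl ?lee_fin// ?addr_ge0// !mul1e sum3.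
Qed.

Lemma gradientP v i j : inH1 v -> is_weak_derivative (v i) j (gradient v (i, j)).
Proof. by move=> [_ /(_ i j)] /(@xgetPex _ (fun=> 0)). Qed.

Lemma gradient_component_le v i j :
  (\int[leb3]_x (gradient v (i, j) x ^+ 2)%:E <= Lp_norm 2%:E (gradient v) ^+ 2)%E.
Proof.
rewrite Lp_norm2_sqr; apply: ge0_le_lower_integral => x; rewrite lee_fin ?sqr_ge0//.
by rewrite (bigD1 (i, j))//= lerDl sumr_ge0// => ij _; exact: sqr_ge0.
Qed.

Lemma gradient_norm_lty v : inH1 v -> (Lp_norm 2%:E (gradient v) ^+ 2 < +oo)%E.
Proof.
move=> H1; rewrite Lp_norm2_sqr.
have H : leb3.-integrable [set: mR3]
   (fun x => \sum_(ij : 'I_3 * 'I_3) (gradient v ij x ^+ 2)%:E)%E.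
  apply: integrable_sum => // -[i j] _.
  have [g2 _] := gradientP i j H1.
  exact: Lfun2_integrable_sqr g2.
have := integrable_fin_num measurableT H.
rewrite ge0_fin_numE; last first.
  by apply: integral_ge0 => x _; apply: sume_ge0 => ij _; rewrite lee_fin sqr_ge0.
apply: le_lt_trans; rewrite le_eqVlt; apply/orP; left; apply/eqP.
by apply: eq_integral => x _; rewrite sumEFin.
Qed.

(** The first bound makes the wavenumber finite for fields in H^1; the second is Bernstein's
    inequality for the averages. *)
Lemma lp_estimates (chi : R3 R -> R) : lp_cutoff chi ->
  exists2 C : R, 0 < C & forall q v, inH1 v ->
  (Lp_norm +oo (lp_piece chi q v) ^+ 2 <=
     (C * lambda q)%:E * Lp_norm 2%:E (gradient v) ^+ 2)%E /\
  ((lambda q ^+ 2)%:E * Lp_norm 2%:E (lp_piece chi q v) ^+ 2 <=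
     C%:E * Lp_norm 2%:E (gradient v) ^+ 2)%E.
Proof.
move=> Hchi; have [C C0 HC] := lp_scalar_estimates Hchi.
(* One factor 3 from the components i, another from bounding each of the three integrals over j by
   the full gradient norm. *)
exists (9 * C); first by rewrite mulr_gt0.
move=> q v H1; have [v2 _] := H1.
have /choice[H HH] : forall i : 'I_3, exists H, _ :=
  fun i => HC q (v i) (fun j => gradient v (i, j)) (v2 i) (fun j => gradientP i j H1).
set N := (Lp_norm 2%:E (gradient v) ^+ 2)%E.
have N0 : (0 <= N)%E by exact: Lp_norm_sqr_ge0.
have L0 : 0 < lambda q :> R by rewrite exprn_gt0.
have GN i : (\sum_(j < 3) \int[leb3]_y (gradient v (i, j) y ^+ 2)%:E <= 3%:E * N)%E.
  rewrite -sum3_cst//.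
  by apply: lee_sum => j _; exact: gradient_component_le.
clearbody N; have tN : (0 <= 3%:E * N)%E by apply: mule_ge0.
have cL : (0 <= (C * lambda q)%:E)%E by rewrite lee_fin ltW// mulr_gt0.
have cV : (0 <= (C * lambda q ^- 2)%:E)%E.
  by rewrite lee_fin ltW// mulr_gt0// invr_gt0 exprn_gt0.
split.
  apply: Lp_normoo_sqr_le => [|x].
    by rewrite mule_ge0// lee_fin !mulr_ge0// ltW.
  rewrite magnitude_sqr -sumEFin.
  apply: (@le_trans _ _ (\sum_(i < 3) (C * lambda q)%:E * (3%:E * N))%E).
    apply: lee_sum => i _; have [_ _ uH Hle _] := HH i.
    apply: (le_trans (uH x)); apply: (le_trans (Hle x)).
    by rewrite lee_wpmul2l// lee_fin mulr_ge0// ltW.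
  rewrite (sum3_cst (mule_ge0 cL tN)).
  rewrite !muleA -!EFinM le_eqVlt; apply/orP; left; apply/eqP.
  by congr (_%:E * _)%E; ring.
rewrite Lp_norm2_sqr.
have HS : (\int[leb3]_x (\sum_i lp_piece chi q v i x ^+ 2)%:E <=
    \sum_(i < 3) \int[leb3]_x H i x)%E.
  rewrite -ge0_integral_sum//; last 2 first.
  - by move=> i; case: (HH i).
  - by move=> i x _; case: (HH i).
  apply: ge0_le_lower_integral => x.
    by rewrite lee_fin sumr_ge0// => i _; exact: sqr_ge0.
  rewrite -sumEFin; apply: lee_sum => i _.
  have [_ _ uH _ _] := HH i; exact: (uH x).
apply: (@le_trans _ _ ((lambda q ^+ 2)%:E * \sum_(i < 3) (C * lambda q ^- 2)%:E * (3%:E * N))%E).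
  rewrite lee_wpmul2l ?lee_fin ?sqr_ge0//; apply: (le_trans HS).
  apply: lee_sum => i _; have [_ _ _ _ Hint] := HH i.
  apply: (le_trans Hint); rewrite exprVn; exact: lee_wpmul2l.
rewrite (sum3_cst (mule_ge0 cV tN)).
rewrite !muleA -!EFinM le_eqVlt; apply/orP; left; apply/eqP.
by congr (_%:E * _)%E; field; rewrite gt_eqF.
Qed.

End VectorEstimates.

Section Wavenumber.
Context {R : realType}.
Implicit Types (v : vfield R).
Variables (chi : R3 R -> R) (c0 nu : R).
Hypothesis Hchi : lp_cutoff chi.
Hypotheses (Hc0 : 0 < c0) (Hnu : 0 < nu).

Lemma lambda_gt0 q : 0 < lambda q :> R.
Proof. by rewrite exprn_gt0. Qed.

Lemma lambda_le p q : (lambda p <= lambda q :> R) = (p <= q)%N.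
Proof. by rewrite /lambda ler_eXn2l// ltr1n. Qed.

Lemma lambda_inj : injective (@lambda R).
Proof.
move=> p q pq; apply/eqP; rewrite eqn_leq -!lambda_le pq lexx.
by [].
Qed.

Let good v q := forall p, (q < p)%N ->
  ((lambda p)^-1%:E * Lp_norm +oo (lp_piece chi p v) < (c0 * nu)%:E)%E.

(** By the L^oo bound, (||v_p||_oo / lambda_p)^2 is at most C ||grad v||_2^2 / lambda_p, which tends
    to 0. *)
Lemma exists_dissipation_index v : inH1 v -> exists q, good v q.
Proof.
move=> H1; have [C C0 HC] := lp_estimates Hchi.
have := gradient_norm_lty H1; move EN : (Lp_norm 2%:E (gradient v) ^+ 2)%E => N Ny.
have N0 : (0 <= N)%E by rewrite -EN; exact: Lp_norm_sqr_ge0.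
have {Ny} [r rN] : exists r, N = r%:E.
  by move: N0 Ny; case: N {EN} => [r| |]// _ _; exists r.
have cn : 0 < c0 * nu by rewrite mulr_gt0.
(* For p > q one has lambda_p = 2^p > p > q, so lambda_p exceeds the quotient as well. *)
pose q := Num.bound (C * r / (c0 * nu) ^+ 2); exists q => p qp.
have [Hp _] := HC p v H1; rewrite EN rN -EFinM in Hp.
have L0 := lambda_gt0 p.
have r0 : 0 <= r by rewrite rN lee_fin in N0.
rewrite ltNge; apply/negP => Hge.
have X0 : (0 <= Lp_norm +oo (lp_piece chi p v))%E by exact: Lnorm_ge0.
have {}Hge : ((c0 * nu * lambda p)%:E <= Lp_norm +oo (lp_piece chi p v))%E.
  by rewrite EFinM -lee_pdivlMr// muleC.
have : (((c0 * nu * lambda p) ^+ 2)%:E <= (C * lambda p * r)%:E)%E.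
  apply: le_trans Hp; rewrite expr2 EFinM expe2.
  by apply: lee_pmul => //; rewrite lee_fin mulr_ge0 ?ltW.
rewrite lee_fin leNgt => /negP; apply.
have qC : C * r / (c0 * nu) ^+ 2 < lambda p.
  apply: (@lt_le_trans _ _ q%:R).
    by apply: le_lt_trans (archi_boundP _); rewrite ?lexx// divr_ge0 ?sqr_ge0// mulr_ge0// ltW.
  apply: (@le_trans _ _ p%:R); first by rewrite ler_nat ltnW.
  rewrite /lambda -natrX ler_nat; exact/ltnW/ltn_expl.
rewrite ltr_pdivrMr ?exprn_gt0// in qC.
have -> : C * lambda p * r = lambda p * (C * r) by ring.
have -> : (c0 * nu * lambda p) ^+ 2 = lambda p * (lambda p * (c0 * nu) ^+ 2) by ring.
by rewrite ltr_pM2l.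
Qed.

(** The admissible indices have a least element m. If m > 0, then m - 1 is not admissible, and since
    every p > m satisfies the smallness condition, it must fail at p = m. For m = 0 this gives no
    lower bound on the critical piece. *)
Lemma wavenumberP v : inH1 v -> let q := wave_index chi c0 nu v in
  wavenumber chi c0 nu v = (lambda q)%:E /\
  ((0 < q)%N -> ((c0 * nu * lambda q)%:E <= Lp_norm +oo (critical_piece chi c0 nu v))%E).
Proof.
move=> H1 q.
have [m /asboolP gm mmin] : exists2 m, `[< good v m >] & forall n, `[< good v n >] -> (m <= n)%N.
  have ex : exists n, `[< good v n >].
    by have [n gn] := exists_dissipation_index H1; exists n; apply/asboolP.
  by exists (ex_minn ex); case: ex_minnP.
have Wm : wavenumber chi c0 nu v = (lambda m)%:E.
  apply/eqP; rewrite eq_le; apply/andP; split.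
    by apply: ereal_inf_lbound; exists m.
  apply: le_ereal_inf_tmp => _ [n gn <-].
  by rewrite lee_fin lambda_le mmin//; apply/asboolP.
have qm : q = m.
  apply: lambda_inj; rewrite /q /wave_index; case: xgetP => [n _ /=|].
    by rewrite Wm => -[].
  by move/(_ m) => /=; rewrite Wm.
rewrite /critical_piece -/q qm; split => // m0.
have ngm : ~ good v m.-1.
  by move/asboolP/mmin; rewrite leqNgt ltn_predL m0.
rewrite leNgt; apply/negP => Hlt; apply: ngm => p.
rewrite prednK// leq_eqVlt => /predU1P[<-|]; last exact: gm.
by rewrite muleC lte_pdivrMr ?lambda_gt0// -EFinM.
Qed.

End Wavenumber.

(** * Averages in time *)

Section Averages.
Context {R : realType}.
Implicit Types (T : R).

Lemma ae_imply (P Q : R -> Prop) : (forall t, P t -> Q t) ->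
  {ae @lebesgue_measure R, forall t, P t} ->
  {ae @lebesgue_measure R, forall t, Q t}.
Proof.
move=> PQ [N [mN N0 PN]]; exists N; split => // t /= nQ.
by apply: PN => /= /PQ.
Qed.

Lemma le_mean T (f g : R -> \bar R) : 0 < T ->
  (forall t, (0 <= f t)%E) -> (forall t, (0 <= g t)%E) ->
  {ae @lebesgue_measure R, forall t, 0 <= t <= T -> (f t <= g t)%E} ->
  (mean T f <= mean T g)%E.
Proof.
move=> T0 f0 g0 fg; rewrite /mean lee_wpmul2l ?lee_fin ?invr_ge0 ?(ltW T0)//.
exact: ae_le_integral.
Qed.

Lemma mean_affine T (g : R -> \bar R) (c b : R) : 0 < T -> 0 <= c -> 0 < b ->
  (forall t, (0 <= g t)%E) ->
  (mean T (fun t => c%:E + b%:E * g t) <= c%:E + b%:E * mean T g)%E.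
Proof.
move=> T0 c0 b0 g0.
have := @lower_integral_affine _ _ R (@lebesgue_measure R) `[0, T]%classic g c b
  (measurable_itv _) c0 b0 g0.
have E : @lebesgue_measure R `[0, T]%classic = T%:E.
  by rewrite lebesgue_measure_itv/= lte_fin T0 oppr0 adde0.
move=> H; rewrite /mean.
apply: (@le_trans _ _ (T^-1%:E * (c%:E * T%:E + b%:E * \int[lebesgue_measure]_(t in `[0%R, T]) g t))%E).
  rewrite lee_wpmul2l ?lee_fin ?invr_ge0 ?(ltW T0)//; apply: (le_trans H).
  rewrite le_eqVlt; apply/orP; left; apply/eqP; congr (_ * _ + _)%E; exact: E.
have i0 : (0 <= \int[lebesgue_measure]_(t in `[0%R, T]) g t)%E by exact: integral_ge0.
rewrite ge0_muleDr//; last 2 first.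
- by rewrite -EFinM lee_fin mulr_ge0// ltW.
- by rewrite mule_ge0// lee_fin ltW.
by rewrite -EFinM mulrCA mulVf ?gt_eqF// mulr1 muleCA.
Qed.

Lemma mean_ge0 T (g : R -> \bar R) : 0 < T -> (forall t, (0 <= g t)%E) ->
  (0 <= mean T g)%E.
Proof.
by move=> T0 g0; rewrite mule_ge0 ?lee_fin ?invr_ge0 ?(ltW T0)// integral_ge0.
Qed.

Lemma meanZ_le T (g : R -> \bar R) (b : R) : 0 < T -> 0 < b ->
  (forall t, (0 <= g t)%E) ->
  (mean T (fun t => b%:E * g t) <= b%:E * mean T g)%E.
Proof.
move=> T0 b0 g0; have := mean_affine T0 (lexx 0) b0 g0.
by under [X in mean T X]eq_fun do rewrite add0e; rewrite add0e.
Qed.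

(** Either L <= A, or (L / A)^(p - 1) >= 1 and the second term alone dominates L. *)
Lemma le_threshold_powR (A p L : R) : 0 < A -> 1 <= p -> 0 < L ->
  L <= A + A `^ (1 - p) * L `^ p.
Proof.
move=> A0 p1 L0.
have [LA|LA] := leP L A; first by rewrite (le_trans LA)// lerDl mulr_ge0 ?powR_ge0.
apply: (@le_trans _ _ (A `^ (1 - p) * L `^ p)); last by rewrite lerDr ltW.
have -> : L `^ p = L * L `^ (p - 1).
  rewrite -[X in X * _]powRr1 ?(ltW L0)// -powRD; first by congr (_ `^ _); ring.
  by rewrite (gt_eqF L0) implybT.
rewrite mulrCA ler_peMr ?(ltW L0)//.
rewrite -[1 - p]opprB powRN mulrC ler_pdivlMr ?powR_gt0// mul1r.
by rewrite ge0_ler_powR ?nnegrE ?subr_ge0 ?(ltW A0) ?(ltW L0) ?(ltW LA).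
Qed.

End Averages.

(** * The bound on the mean wavenumber *)

Section Main.
Context {R : realType}.

(** A is left free because the intended value kappa_d vanishes together with the dissipation, a case
    settled by letting A tend to 0. The summand 1 is [lambda 0], and C is fixed before nu, T, s and
    u. *)
Lemma mean_wavenumber_le (chi : R3 R -> R) (c0 K : R) :
  lp_cutoff chi -> 0 < c0 -> 0 < K ->
  exists2 C : R, 0 < C &
  forall (nu T s : R) (u : R -> vfield R), 0 < nu -> 0 < T -> s <= 3 ->
  in_L2H1 T u ->
  let Lambda t := wavenumber chi c0 nu (u t) in
  let u_Q t := critical_piece chi c0 nu (u t) in
  (mean T (fun t => Lambda t `^ (2 - s) * Lp_norm +oo (u_Q t) ^+ 2) <=
   K%:E * mean T (fun t => Lambda t ^+ 2 * Lp_norm 2%:E (u_Q t) ^+ 2))%E ->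
  forall A : R, 0 < A ->
  (mean T Lambda <= (1 + A)%:E + (C * nu ^- 2 * A `^ (s - 3))%:E *
     mean T (fun t => Lp_norm 2%:E (gradient (u t)) ^+ 2))%E.
Proof.
move=> Hchi c00 K0; have [C C0 HC] := lp_estimates Hchi.
exists (c0 ^- 2 * K * C); first by rewrite !mulr_gt0// invr_gt0 exprn_gt0.
move=> nu T s u nu0 T0 s3 [H1 _] Lambda u_Q Hyp A A0.
pose Y t := (Lambda t `^ (2 - s) * Lp_norm +oo (u_Q t) ^+ 2)%E.
pose Z t := (Lambda t ^+ 2 * Lp_norm 2%:E (u_Q t) ^+ 2)%E.
pose G t := (Lp_norm 2%:E (gradient (u t)) ^+ 2)%E.
have Y0 t : (0 <= Y t)%E by rewrite mule_ge0 ?poweR_ge0// Lp_norm_sqr_ge0.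
have L0 t : (0 <= Lambda t)%E.
  by apply: le_ereal_inf_tmp => _ [q _ <-]; rewrite lee_fin ltW// lambda_gt0.
have Z0 t : (0 <= Z t)%E by rewrite mule_ge0 ?Lp_norm_sqr_ge0// expe2 mule_ge0.
have G0 t : (0 <= G t)%E by exact: Lp_norm_sqr_ge0.
pose b := A `^ (s - 3) * (c0 * nu) ^- 2.
have cn : 0 < c0 * nu by rewrite mulr_gt0.
have b0 : 0 < b by rewrite mulr_gt0 ?powR_gt0// invr_gt0 exprn_gt0.
apply: (@le_trans _ _ (mean T (fun t => (1 + A)%:E + b%:E * Y t)%E)).
  apply: le_mean => //.
    move=> t; apply: adde_ge0; first by rewrite lee_fin addr_ge0// ltW.
    by apply: mule_ge0 => //; rewrite lee_fin ltW.
  apply: ae_imply H1 => t /[apply] H1.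
  have := wavenumberP Hchi c00 nu0 H1.
  rewrite /Y /u_Q -/(Lambda t); set q := wave_index _ _ _ _ => -[-> Hq].
  have lq := @lambda_gt0 R q.
  (* At Q = 0 minimality is silent; there Lambda = 1 is absorbed by the summand 1. *)
  have [q0|q0] := posnP q.
    rewrite (@le_trans _ _ 1%:E)//; first by rewrite q0 /lambda expr0.
    rewrite (@le_trans _ _ (1 + A)%:E)//; first by rewrite lee_fin lerDl ltW.
    by rewrite leeDl// mule_ge0 ?lee_fin ?(ltW b0)// mule_ge0 ?poweR_ge0// Lp_norm_sqr_ge0.
  have X0 : (0 <= Lp_norm +oo (critical_piece chi c0 nu (u t)))%E by exact: Lnorm_ge0.
  have X2 : (((c0 * nu * lambda q) ^+ 2)%:E <= Lp_norm +oo (critical_piece chi c0 nu (u t)) ^+ 2)%E.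
    by rewrite expr2 EFinM expe2; apply: lee_pmul; rewrite ?Hq// lee_fin mulr_ge0 ?ltW.
  rewrite poweR_EFin.
  apply: (@le_trans _ _ ((1 + A)%:E + b%:E *
      ((lambda q `^ (2 - s))%:E * ((c0 * nu * lambda q) ^+ 2)%:E))%E); last first.
    by rewrite leeD2l// lee_wpmul2l ?lee_fin ?(ltW b0)// lee_wpmul2l// lee_fin powR_ge0.
  rewrite -!EFinM -EFinD lee_fin.
  have -> : b * (lambda q `^ (2 - s) * (c0 * nu * lambda q) ^+ 2) =
      A `^ (1 - (4 - s)) * lambda q `^ (4 - s).
    have -> : lambda q `^ (4 - s) = lambda q `^ (2 - s) * lambda q ^+ 2.
      rewrite -[lambda q ^+ 2]powR_mulrn ?(ltW lq)// -powRD.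
        by congr (_ `^ _); ring.
      by rewrite (gt_eqF lq) implybT.
    have -> : 1 - (4 - s) = s - 3 by ring.
    by rewrite /b; field; rewrite !gt_eqF.
  apply: (le_trans (le_threshold_powR (p := 4 - s) A0 _ lq)); first lra.
  by rewrite lerD2r lerDr.
apply: (le_trans (mean_affine T0 _ b0 Y0)); first by rewrite addr_ge0// ltW.
rewrite leeD2l//.
apply: (@le_trans _ _ (b%:E * (K%:E * (C%:E * mean T G)))%E); last first.
  rewrite !muleA -!EFinM le_eqVlt; apply/orP; left; apply/eqP.
  by congr (_%:E * _)%E; rewrite /b; field; rewrite !gt_eqF.
rewrite lee_wpmul2l ?lee_fin ?(ltW b0)//; apply: (le_trans Hyp).
rewrite lee_wpmul2l ?lee_fin ?(ltW K0)//.
apply: le_trans (meanZ_le T0 C0 G0); apply: le_mean => //.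
  by move=> t; rewrite mule_ge0 ?lee_fin ?(ltW C0).
apply: ae_imply H1 => t /[apply] H1.
rewrite /Z /Lambda (wavenumberP Hchi c00 nu0 H1).1 /u_Q /critical_piece expe2 -EFinM -expr2.
by have [_] := HC (wave_index chi c0 nu (u t)) (u t) H1.
Qed.

End Main.

(** For u = 0 the wavenumber is constantly [lambda 0] while kappa_d = 0; this is why [lambda 0] is
    subtracted from the mean. *)
Theorem mainTheorem7 (R : realType) (chi : R3 R -> R) (c0 K : R)
    (Hchi : lp_cutoff chi) (Hc0 : 0 < c0) (HK : 0 < K) :
  exists C : R, 0 < C /\
  forall (nu T s : R) (u0 : vfield R) (u : R -> vfield R),
  0 < nu -> 0 < T -> 0 <= s <= 3 ->
  leray_hopf nu T u0 u ->
  let Lambda t := wavenumber chi c0 nu (u t) in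
  let u_Q t := critical_piece chi c0 nu (u t) in
  let d := 3 - s in
  (mean T (fun t => Lambda t `^ (2 - s) * Lp_norm +oo (u_Q t) ^+ 2) <=
   K%:E * mean T (fun t => Lambda t ^+ 2 * Lp_norm 2%:E (u_Q t) ^+ 2))%E ->
  (mean T Lambda - (lambda 0)%:E <= C%:E * kolmogorov nu T u d)%E.
Proof.
have [C C0 HC] := mean_wavenumber_le Hchi Hc0 HK.
exists (1 + C); split; first by rewrite addr_gt0.
move=> nu T s u0 u nu0 T0 /andP[s0 s3] [_ _ _ uH1 _] Lambda u_Q d Hyp.
have {}HC := HC nu T s u nu0 T0 s3 uH1 Hyp.
rewrite /kolmogorov /dissipation /lambda expr0.
have d1 : 0 < d + 1 by rewrite /d; lra.
move: HC; set E := mean T (fun t => Lp_norm 2%:E _ ^+ 2)%E => HC.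
have : (0 <= E)%E by apply: mean_ge0 => // t; exact: Lp_norm_sqr_ge0.
(* An infinite mean makes kappa_d infinite, its exponent being nonzero, and the bound is trivial. *)
case: E HC => [e| |] // HC e0; last first.
  have -> : (nu%:E * +oo * (nu ^- 3)%:E)%E = +oo%E :> \bar R.
    by rewrite gt0_muley ?lte_fin// gt0_mulye// lte_fin invr_gt0 exprn_gt0.
  by rewrite poweRyr ?invr_neq0 ?gt_eqF// gt0_muley ?leey// lte_fin addr_gt0.
rewrite lee_fin in e0.
rewrite -!EFinM leeBlDr//.
have -> : nu * e * nu ^- 3 = e * nu ^- 2 by field; rewrite gt_eqF.
(* Zero dissipation would give A = 0, which is not allowed; the bound by 1 + A holds for every A >
   0, hence the mean is at most 1. *)
have [e00|e_gt0] := leP e 0.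
  have -> : e = 0 by apply/eqP; rewrite eq_le e00 e0.
  rewrite mul0r powR0 ?invr_neq0 ?gt_eqF// mulr0 add0e.
  apply/lee_addgt0Pr => A A0; have := HC A A0.
  have -> : e = 0 by apply/eqP; rewrite eq_le e00 e0.
  by rewrite mule0 adde0 EFinD.
have x0 : 0 < e * nu ^- 2 by rewrite mulr_gt0// invr_gt0 exprn_gt0.
set A := (e * nu ^- 2) `^ (d + 1)^-1.
have A0 : 0 < A by exact: powR_gt0.
apply: (le_trans (HC A A0)); rewrite -EFinM -!EFinD lee_fin.
have Ap : A `^ (d + 1) = e * nu ^- 2.
  by rewrite -powRrM mulVf ?gt_eqF// powRr1// ltW.
(* The choice of A turns the dissipation term into a power of A, and (s - 3) + (d + 1) = 1 makes it
   a multiple of A itself. *)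
have -> : C * nu ^- 2 * A `^ (s - 3) * e = C * (A `^ (s - 3) * A `^ (d + 1)).
  by rewrite Ap; ring.
rewrite -powRD ?(gt_eqF A0) ?implybT//.
have -> : s - 3 + (d + 1) = 1 by rewrite /d; ring.
by rewrite powRr1 ?(ltW A0)// mulrDl mul1r -addrA [leRHS]addrC.
Qed.
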